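(* Let $d\ge 3$ and let $X\subset\mathbb{E}^d$ be a nonempty compact set with $\mathrm{diam}(X)\le 1$, so that $\mathbf{B}[X]$ is a spindle convex body in $\mathbb{E}^d$. Then $$I(\mathbf{B}[X])<4\left(\frac{\pi}{3}\right)^{\frac12}d^{\frac32}(3+\ln d)\left(\frac32\right)^{\frac d2}<5d^{\frac32}(4+\ln d)\left(\frac32\right)^{\frac d2}.$$
   Context: $\mathbb{E}^d$ is $d$-dimensional Euclidean space, $\mathbb{S}^{d-1}$ is its unit sphere centered at the origin, and $\mathrm{diam}$ denotes Euclidean diameter. For a compact set $X\subset\mathbb{E}^d$, $\mathbf{B}[X]$ denotes the intersection of the closed $d$-dimensional unit balls (radius $1$) centered at the points of $X$; it is called a spindle convex body if it has nonempty interior. Illumination number: a direction $\mathbf{v}\in\mathbb{S}^{d-1}$ illuminates a boundary point $\mathbf{b}$ of a convex body $\mathbf{K}$ (compact convex set with nonempty interior) if the halfline emanating from $\mathbf{b}$ with direction vector $\mathbf{v}$ intersects the interior of $\mathbf{K}$. Directions $\mathbf{v}_1,\dots,\mathbf{v}_n$ illuminate $\mathbf{K}$ if each boundary point of $\mathbf{K}$ is illuminated by at least one of them. $I(\mathbf{K})$ is the smallest $n$ for which there exist $n$ directions that illuminate $\mathbf{K}$. *)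

(* Defs.v *)
From HB Require Import structures.
From mathcomp Require Import all_boot all_order all_algebra.
From mathcomp Require Import all_classical all_reals all_analysis.

Set Implicit Arguments.
Unset Strict Implicit.
Unset Printing Implicit Defensive.

Import Order.TTheory GRing.Theory Num.Theory.
Import numFieldNormedType.Exports.

Local Open Scope classical_set_scope.
Local Open Scope ring_scope.

(* The d-dimensional Euclidean space is 'rV[R]_d.  The library norm `|x| on it
   is the sup norm, so the Euclidean norm is defined here.  The product
   topology of 'rV[R]_d, used for compactness and interiors, coincides with the
   Euclidean one. *)
Definition enorm (R : realType) (d : nat) (x : 'rV[R]_d) : R :=
  Num.sqrt (\sum_(i < d) x 0 i ^+ 2).

Definition unit_sphere (R : realType) (d : nat) : set 'rV[R]_d :=
  [set v | enorm v = 1].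

(* Extended-real valued, so that no junk value arises for unbounded sets. *)
Definition diam (R : realType) (d : nat) (X : set 'rV[R]_d) : \bar R :=
  ereal_sup [set (enorm (p.1 - p.2))%:E | p in X `*` X].

Definition unit_ball (R : realType) (d : nat) (x : 'rV[R]_d) : set 'rV[R]_d :=
  [set y | enorm (y - x) <= 1].

Definition ball_body (R : realType) (d : nat) (X : set 'rV[R]_d) :
    set 'rV[R]_d :=
  \bigcap_(x in X) unit_ball x.

(* X is required to be nonempty since ball_body set0 is the whole space. *)
Definition spindle_convex_body (R : realType) (d : nat) (K : set 'rV[R]_d) :
    Prop :=
  exists X : set 'rV[R]_d,
    [/\ X !=set0, compact X, K = ball_body X & K° !=set0].

Definition boundary (R : realType) (d : nat) (K : set 'rV[R]_d) :
    set 'rV[R]_d :=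
  closure K `\` K°.

Definition halfline (R : realType) (d : nat) (b v : 'rV[R]_d) :
    set 'rV[R]_d :=
  [set b + t *: v | t in [set t : R | 0 <= t]].

Definition illuminates_point (R : realType) (d : nat) (K : set 'rV[R]_d)
    (v b : 'rV[R]_d) : Prop :=
  halfline b v `&` K° !=set0.

Definition illuminable_by (R : realType) (d : nat) (K : set 'rV[R]_d)
    (n : nat) : Prop :=
  exists v : 'I_n -> 'rV[R]_d,
    (forall i, unit_sphere (v i)) /\
    (forall b, boundary K b -> exists i, illuminates_point K (v i) b).

(* I(K) = n.  I(K) is defined as a relation because no finite family of
   directions may exist for an arbitrary set K. *)
Definition is_illumination_number (R : realType) (d : nat)
    (K : set 'rV[R]_d) (n : nat) : Prop :=
  illuminable_by K n /\ forall m : nat, illuminable_by K m -> (n <= m)%N.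

(* Main.v *)
(** Let [K = B[X]].  A direction [v] illuminates a boundary point [b] of [K] as
    soon as [<v, x - b> > 0] for every [x] in [X] at distance 1 from [b].  Cut a
    cube containing [K] into [M] small cells; the unit vectors [x - b] with [b] in
    a given cell form a set [F] of diameter at most [D = 1 + O(1/d)].  An almost
    shortest point of the convex hull of [F] gives a center [u] with [<u, f>]
    almost [sqrt (1 - D^2 / 2)] on [F].  Following Schramm, the polar cone of [F]
    and its reflection in the axis [u] cover a circular cone of slope close to
    [sqrt 2], so a standard Gaussian vector lies in the polar cone with probability
    at least [p], half the Gaussian measure of that circular cone, which is of
    order [(2/3)^(d/2) / sqrt d].  Choosing directions greedily, [N] of them leave
    at most [M e^(- p N)] cells, which are then treated one by one.

    The Gaussian mean on [R^n] is only needed on bounded Lipschitz functions,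
    where it is an iterated one-dimensional integral; its rotation invariance
    reduces to the plane, where a rotation is a product of shears. *)
Require Import Defs.
From HB Require Import structures.
From mathcomp Require Import all_boot all_order all_algebra.
From mathcomp Require Import all_classical all_reals all_analysis.
From mathcomp Require Import measurable_realfun ring lra.
Import Order.TTheory GRing.Theory Num.Theory.
Import numFieldNormedType.Exports.
Local Open Scope classical_set_scope.
Local Open Scope ring_scope.

Set Implicit Arguments.
Unset Strict Implicit.
Unset Printing Implicit Defensive.


(** * Gaussian integrals on the line and in the plane *)

(** The exponent dictates the scales. For unit vectors at mutual distance at most D, the reflection
    argument accepts every slope below (2 / D) sqrt (1 - D^2 / 2), which is sqrt 2 for D = 1, and
    the measure of a cone of slope sqrt 2 is governed by (1 + 1/2)^(-n/2). A relative error O(1/d)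
    in the slope costs only a constant factor in that power, so cells of diameter O(1/d), that is of
    side O(d^(-3/2)), are fine enough. Then ln M is about (3/2) d ln d, and N about ln M / p leaves
    a bounded number of cells: this is the source of the factor ln d.

    No cone is ever measured. Its indicator is replaced by a clamped Lipschitz function, at the
    price of reaching every value below p but not p itself; finiteness of the set of cells restores
    p. The explicit constants must already hold at d = 3, which is why the numerical part carries
    corrections in 1/d instead of limits. *)

Lemma open2_measurable (R : realType) (U : set (R * R)) :
  open U -> measurable (U : set (measurableTypeR R * measurableTypeR R)).
Proof.
move=> oU.
pose box (a b r : rat) : set (R * R) :=
  ball (ratr a : R) (ratr r : R) `*` ball (ratr b : R) (ratr r : R).
have -> : U = \bigcup_a \bigcup_b \bigcup_r
    (if asbool (box a b r `<=` U) then box a b r else set0).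
  apply/seteqP; split=> [[x y] Uxy|[x y] [a _ [b _ [r _]]]]; last first.
    by case: ifPn => // /asboolP sU; exact: sU.
  have [e /= e0 He] : nbhs_ball (x, y) U by apply/nbhs_ballP; exact: open_nbhs_nbhs.
  (* With 2 r < e, any rational square of radius r whose center is within r of (x, y) contains (x,
     y) and stays in the e-ball. *)
  have [r /andP[]] : exists q : rat, ratr q \in `]0, e / 2[ by apply: rat_in_itvoo; lra.
  rewrite bnd_simp => r0; rewrite bnd_simp => re.
  have [a /andP[]] : exists q : rat, ratr q \in `]x - ratr r, x + ratr r[.
    by apply: rat_in_itvoo; lra.
  rewrite bnd_simp => a0; rewrite bnd_simp => ae.
  have [b /andP[]] : exists q : rat, ratr q \in `]y - ratr r, y + ratr r[.
    by apply: rat_in_itvoo; lra.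
  rewrite bnd_simp => b0; rewrite bnd_simp => be.
  exists a => //; exists b => //; exists r => //.
  rewrite ifT.
    by split => /=; rewrite /ball /= ltr_norml; apply/andP; split; lra.
  apply/asboolP => -[u v] [/=]; rewrite /ball /= !ltr_norml.
  move=> /andP[? ?] /andP[? ?]; apply: He.
  by split; rewrite /= /ball /= ltr_norml; apply/andP; split; lra.
apply: bigcupT_measurable_rat => a; apply: bigcupT_measurable_rat => b.
apply: bigcupT_measurable_rat => r; case: ifP => _ //.
by apply: measurableX; apply: open_measurable; exact: ball_open.
Qed.

Lemma continuous2_measurable_fun (R : realType) (f : R * R -> R) :
  continuous f ->
  measurable_fun setT (f : measurableTypeR R * measurableTypeR R -> R).
Proof.
move=> cf; apply: (measurability _ (RGenOpens.measurableE R)).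
move=> _ [_ [a [b ->] <-]].
rewrite setTI; apply: open2_measurable.
by apply: open_comp => // x _; exact: cf.
Qed.

Lemma ge0_integral_shift (R : realType) (h : R -> R) (c : R) :
  continuous h -> (forall x, 0 <= h x) ->
  (\int[lebesgue_measure]_x (h (x + c))%:E = \int[lebesgue_measure]_x (h x)%:E)%E.
Proof.
move=> ch h0.
have dF (x : R) : is_derive x 1 (fun x : R => x + c) 1.
  by rewrite -[X in is_derive _ _ _ X]addr0; apply: is_deriveD.
have F' : (fun x : R => x + c)^`()%classic = cst 1.
  by apply/funext => x; rewrite derive1E derive_val.
rewrite [RHS](@increasing_ge0_integration_by_substitutionT R (fun x => x + c))//.
- by apply: eq_integral => x _; rewrite F' /= mulr1.
- by move=> x y; rewrite ltrD2r.
- by rewrite F'; move=> ?; exact: cvg_cst.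
- by rewrite F'; exact: is_cvg_cst.
- by rewrite F'; exact: is_cvg_cst.
- exact: cvg_addrr_Ny.
- exact: cvg_addrr.
Qed.

Section plane.
Variable R : realType.
Implicit Type h : R * R -> R.

Definition plane_integral h : \bar R :=
  (\int[lebesgue_measure]_x \int[lebesgue_measure]_y (h (x, y))%:E)%E.

Lemma continuous_pair_comp h (u v : R * R -> R) :
  continuous h -> continuous u -> continuous v ->
  continuous (fun p => h (u p, v p)).
Proof.
move=> ch cu cv p.
apply: (@continuous_comp _ _ _ (fun p => (u p, v p)) h); last exact: ch.
exact: (cvg_pair (cu p) (cv p)).
Qed.

Lemma continuous_lin2 (a b : R) : continuous (fun p : R * R => a * p.1 + b * p.2).
Proof.
move=> p; apply: cvgD; apply: cvgM; do ?exact: cvg_cst.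
  exact: cvg_fst.
exact: cvg_snd.
Qed.

Lemma continuous_curry1 h (x : R) : continuous h -> continuous (fun y => h (x, y)).
Proof.
move=> ch y; apply: (@continuous_comp _ _ _ (fun y => (x, y)) h); last exact: ch.
exact: (cvg_pair (cvg_cst x) cvg_id).
Qed.

Lemma continuous_curry2 h (y : R) : continuous h -> continuous (fun x => h (x, y)).
Proof.
move=> ch x; apply: (@continuous_comp _ _ _ (fun x => (x, y)) h); last exact: ch.
exact: (cvg_pair cvg_id (cvg_cst y)).
Qed.

Lemma plane_integral_swap h : continuous h -> (forall p, 0 <= h p) ->
  plane_integral h =
  (\int[lebesgue_measure]_y \int[lebesgue_measure]_x (h (x, y))%:E)%E.
Proof.
move=> ch h0; rewrite /plane_integral.
apply: (@fubini_tonelli _ _ (measurableTypeR R) (measurableTypeR R) R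
  lebesgue_measure lebesgue_measure (EFin \o h)).
  by apply/measurable_EFinP; exact: continuous2_measurable_fun.
by move=> p; rewrite lee_fin.
Qed.

Lemma plane_integral_shear2 h (a : R) : continuous h -> (forall p, 0 <= h p) ->
  plane_integral (fun p => h (p.1, a * p.1 + p.2)) = plane_integral h.
Proof.
move=> ch h0; apply: eq_integral => x _ /=.
under eq_integral do rewrite addrC.
by apply: ge0_integral_shift => //; exact: continuous_curry1.
Qed.

Lemma plane_integral_shear1 h (a : R) : continuous h -> (forall p, 0 <= h p) ->
  plane_integral (fun p => h (p.1 + a * p.2, p.2)) = plane_integral h.
Proof.
move=> ch h0.
rewrite (plane_integral_swap ch h0) plane_integral_swap//; first last.
  apply: continuous_pair_comp => //; last by move=> p; exact: cvg_snd.
  by under eq_fun do rewrite -[_.1]mul1r; exact: continuous_lin2.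
apply: eq_integral => y _ /=.
by apply: ge0_integral_shift => //; exact: continuous_curry2.
Qed.

(* A rotation other than [-id] is a product of three shears. *)
Lemma plane_integral_rot h (c s : R) : continuous h -> (forall p, 0 <= h p) ->
  c ^+ 2 + s ^+ 2 = 1 -> s != 0 ->
  plane_integral (fun p => h (c * p.1 + s * p.2, - s * p.1 + c * p.2)) =
  plane_integral h.
Proof.
(* For c = cos T and s = sin T this is tan (T / 2), the coefficient of both outer shears; the middle
   one has coefficient -s. *)
move=> ch h0 cs s0; pose a := (1 - c) / s.
have cl1 (b : R) : continuous (fun p : R * R => p.1 + b * p.2).
  by under eq_fun do rewrite -[_.1]mul1r; exact: continuous_lin2.
have cl2 (b : R) : continuous (fun p : R * R => b * p.1 + p.2).
  by under eq_fun do rewrite -[_.2]mul1r; exact: continuous_lin2.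
pose h1 p := h (p.1 + a * p.2, p.2).
pose h2 p := h1 (p.1, - s * p.1 + p.2).
have ch1 : continuous h1.
  by apply: continuous_pair_comp => // p; exact: cvg_snd.
have ch2 : continuous h2.
  by apply: continuous_pair_comp => // p; exact: cvg_fst.
apply: etrans (plane_integral_shear1 a ch h0).
apply: etrans (plane_integral_shear2 (- s) ch1 _) => [|?]; last exact: h0.
apply: etrans (plane_integral_shear1 a ch2 _) => [|?]; last exact: h0.
congr plane_integral; apply/funext => -[x y]; rewrite /h2 /h1 /=.
have as1 : a * s = 1 - c by rewrite /a mulfVK.
have aa : a * (1 + c) = s.
  apply: (mulIf s0); rewrite mulrAC as1 -[RHS]expr2.
  by rewrite -[s ^+ 2](addKr (c ^+ 2)) cs; ring.
congr (h (_, _)).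
  rewrite -[in LHS]aa; transitivity ((1 - a * s) * x + (a * (1 - a * s) + a) * y).
    by rewrite as1; ring.
  by ring.
transitivity (- s * x + (1 - a * s) * y); last by ring.
by rewrite as1; ring.
Qed.

End plane.

Section gauss_mean.
Variable R : realType.
Implicit Types f : R -> R.

Definition gauss_mean f : R :=
  (\int[lebesgue_measure]_x (normal_pdf 0 1 x * f x))%R.

Definition bounded_fun1 f := exists B, forall x, `|f x| <= B.

Lemma integrable_gauss f : measurable_fun setT f -> bounded_fun1 f ->
  lebesgue_measure.-integrable setT (fun x => (normal_pdf 0 1 x * f x)%:E).
Proof.
move=> mf [B fB].
apply: (@le_integrable _ _ R lebesgue_measure setT measurableT _
  (fun x => B%:E * (normal_pdf 0 1 x)%:E)%E).
- apply/measurable_EFinP; apply: measurable_funM => //.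
  exact: measurable_normal_pdf.
- move=> x _ /=; rewrite lee_fin !normrM mulrC.
  by rewrite ler_wpM2r// (le_trans (fB x))// ler_norm.
- by apply: integrableZl => //; exact: integrable_normal_pdf.
Qed.

Lemma gauss_meanD f f' : measurable_fun setT f -> bounded_fun1 f ->
    measurable_fun setT f' -> bounded_fun1 f' ->
  gauss_mean (fun x => f x + f' x) = gauss_mean f + gauss_mean f'.
Proof.
move=> mf bf mf' bf'; rewrite /gauss_mean.
under eq_Rintegral do rewrite mulrDr.
by rewrite RintegralD//; exact: integrable_gauss.
Qed.

Lemma gauss_meanZ f (k : R) : measurable_fun setT f -> bounded_fun1 f ->
  gauss_mean (fun x => k * f x) = k * gauss_mean f.
Proof.
move=> mf bf; rewrite /gauss_mean.
under eq_Rintegral do rewrite mulrCA.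
by rewrite RintegralZl//; exact: integrable_gauss.
Qed.

Lemma le_gauss_mean f f' : measurable_fun setT f -> bounded_fun1 f ->
    measurable_fun setT f' -> bounded_fun1 f' ->
  (forall x, f x <= f' x) -> gauss_mean f <= gauss_mean f'.
Proof.
move=> mf bf mf' bf' ff'; apply: le_Rintegral => //; do ?exact: integrable_gauss.
by move=> x _; rewrite ler_wpM2l// normal_pdf_ge0.
Qed.

Lemma gauss_mean_cst (k : R) : gauss_mean (fun=> k) = k.
Proof.
rewrite /gauss_mean.
rewrite RintegralZr//; last by apply: integrable_normal_pdf.
by rewrite /Rintegral integral_normal_pdf// mul1r.
Qed.

Lemma normal_pdf01E (x : R) :
  normal_pdf 0 1 x = (Num.sqrt (pi *+ 2))^-1 * expR (- (x ^+ 2 / 2)).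
Proof.
by rewrite normal_pdfE// /normal_peak /normal_fun subr0 expr1n mul1r mulNr.
Qed.

(** Cut at 0, the integral becomes a sum whose two terms are exchanged by x -> -x. *)
Lemma ge0_integral_halves f : continuous f -> (forall x, 0 <= f x) ->
  (\int[lebesgue_measure]_x (f x)%:E =
   \int[lebesgue_measure]_(x in `[0%R, +oo[) (f x)%:E +
   \int[lebesgue_measure]_(x in `[0%R, +oo[) (f (- x))%:E)%E.
Proof.
move=> cf f0.
have mf D : measurable_fun D (fun x => (f x)%:E).
  by apply/measurable_EFinP/measurable_funTS; exact: continuous_measurable_fun.
have -> : [set: R] = `[0%R, +oo[ `|` `]-oo, 0%R[.
  by rewrite -setCitvr setUv.
rewrite ge0_integral_setU//=; last 2 first.
- by move=> x _; rewrite lee_fin.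
- by rewrite -setCitvr; exact/disj_setPCl.
congr (_ + _)%E.
rewrite integral_itv_bndo_bndc// -{1}oppr0 ge0_integration_by_substitutionNy//.
  exact: continuous_subspaceT.
exact: mf.
Qed.

Lemma gauss_meanN f : continuous f -> (forall x, 0 <= f x) ->
  gauss_mean (fun x => f (- x)) = gauss_mean f.
Proof.
move=> cf f0; rewrite /gauss_mean /Rintegral; congr fine.
pose h (x : R) := normal_pdf 0 1 x * f x.
have ch : continuous h.
  by move=> x; apply: cvgM; [exact: continuous_normal_pdf|exact: cf].
have h0 x : 0 <= h x by rewrite mulr_ge0// normal_pdf_ge0.
transitivity (\int[lebesgue_measure]_x (h (- x))%:E)%E.
  by apply: eq_integral => x _; rewrite /h !normal_pdf01E sqrrN.
rewrite (ge0_integral_halves ch h0) ge0_integral_halves//; last first.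
  move=> x; apply: (@continuous_comp _ _ _ (-%R) h); last exact: ch.
  exact: oppr_continuous.
by rewrite addeC; congr (_ + _)%E; apply: eq_integral => x _; rewrite opprK.
Qed.

(** The factor x e^(-b x^2) is largest at x = 1 / sqrt (2 b). With z = 2 b x^2 the claim squares to
    z <= e^(z - 1). *)
Lemma mul_expR_sqr_le (b x : R) : 0 < b ->
  Num.sqrt (2 * expR 1 * b) * (x * expR (- (b * x ^+ 2))) <= 1.
Proof.
move=> b0; have [x0|x0] := lerP x 0.
  by rewrite (@le_trans _ _ 0)// mulr_ge0_le0// mulr_le0_ge0// expR_ge0.
pose z := 2 * b * x ^+ 2.
have ze : z <= expR (z - 1) by have := expR_ge1Dx (z - 1); rewrite subrKC.
have -> : x * expR (- (b * x ^+ 2)) = Num.sqrt (x ^+ 2 * expR (- z)).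
  rewrite sqrtrM ?sqr_ge0// sqrtr_sqr gtr0_norm//; congr (_ * _).
  rewrite -[LHS]ger0_norm ?expR_ge0// -sqrtr_sqr -expRM_natl; congr (Num.sqrt (expR _)).
  by rewrite /z; ring.
rewrite -sqrtrM; last by rewrite !mulr_ge0 ?expR_ge0// ltW.
rewrite -[leRHS]sqrtr1 ler_sqrt//.
have -> : 2 * expR 1 * b * (x ^+ 2 * expR (- z)) = z * expR (1 - z).
  by rewrite expRD /z; ring.
rewrite -[leRHS](expRxMexpNx_1 (z - 1)) opprB.
by rewrite ler_wpM2r// expR_ge0.
Qed.

Lemma integral_expR_tail (a s : R) : 0 < a -> 0 <= s ->
  (\int[lebesgue_measure]_(x in `[s, +oo[) (2 * a * x * expR (- (a * x ^+ 2)))%:E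
   = (expR (- (a * s ^+ 2)))%:E)%E.
Proof.
move=> a0 s0.
pose F (x : R) := - expR (- (a * x ^+ 2)).
have dF (x : R) : is_derive x 1 F (2 * a * x * expR (- (a * x ^+ 2))).
  by apply: is_derive_eq; rewrite /GRing.scale /= ; ring.
have cf : continuous (fun x : R => 2 * a * x * expR (- (a * x ^+ 2))).
  move=> x; apply: cvgM; first by apply: cvgM; [exact: cvg_cst|exact: cvg_id].
  apply: (@continuous_comp _ _ _ (fun x : R => - (a * x ^+ 2)) expR).
    by apply: cvgN; apply: cvgM; [exact: cvg_cst|exact: exprn_continuous].
  exact: continuous_expR.
rewrite (@ge0_continuous_FTC2y _ _ F s 0).
- by rewrite -EFinB /F sub0r opprK.
- by move=> x sx; rewrite !mulr_ge0 ?expR_ge0 ?(ltW a0)// (le_trans s0).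
- exact: continuous_subspaceT.
- rewrite -oppr0; apply: cvgN.
  have -> : (fun x : R => expR (- (a * x ^+ 2))) = gauss_fun \o (fun x => Num.sqrt a * x).
    by apply/funext => x; rewrite /gauss_fun /= exprMn sqr_sqrtr// ltW.
  apply: (@cvg_comp _ _ _ (fun x => Num.sqrt a * x) (@gauss_fun R) _ +oo%R).
    by apply: gt0_cvgMry; [rewrite sqrtr_gt0|exact: cvg_id].
  exact: cvg_gauss_fun.
- by move=> x _; have := dF x.
- apply: cvg_at_right_filter; apply/differentiable_continuous/derivable1_diffP.
  by have := dF s.
- by move=> x _; rewrite derive1E derive_val.
Qed.

(* The largest [C] such that [C (1 + 2 b) x e^(- (1/2 + b) x^2)], which integrates
   to [C e^(- (1/2 + b) s^2)] on [s, +oo[, stays below the normal density. *)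
Definition tail_cst (b : R) :=
  Num.sqrt (2 * expR 1 * b) / (Num.sqrt (pi *+ 2) * (1 + 2 * b)).

Lemma tail_cst_gt0 (b : R) : 0 < b -> 0 < tail_cst b.
Proof.
move=> b0; rewrite divr_gt0// ?mulr_gt0// ?sqrtr_gt0 ?mulr_gt0 ?expR_gt0//.
  by rewrite pmulrn_rgt0// pi_gt0.
lra.
Qed.

(** A lower bound of the form C e^(-a s^2) is wanted, rather than a sharper tail estimate, because s
    will be proportional to the norm of the other coordinates: the bound is then again a Gaussian,
    which integrates exactly. *)
Lemma gauss_mean_tail (b s : R) f : 0 < b -> 0 <= s ->
  measurable_fun setT f -> bounded_fun1 f -> (forall x, 0 <= f x) ->
  (forall x, s <= x -> 1 <= f x) ->
  tail_cst b * expR (- ((2^-1 + b) * s ^+ 2)) <= gauss_mean f.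
Proof.
move=> b0 s0 mf bf f0 f1; set a := 2^-1 + b.
have a0 : 0 < a by rewrite /a; lra.
have tc0 := tail_cst_gt0 b0.
have mg (D : set R) : measurable_fun D (fun x => (normal_pdf 0 1 x * f x)%:E).
  apply/measurable_EFinP/measurable_funTS; apply: measurable_funM => //.
  exact: measurable_normal_pdf.
have g0 x : (0 <= (normal_pdf 0 1 x * f x)%:E)%E.
  by rewrite lee_fin mulr_ge0// normal_pdf_ge0.
have gE : (gauss_mean f)%:E =
    (\int[lebesgue_measure]_x (normal_pdf 0 1 x * f x)%:E)%E.
  rewrite fineK//; apply: integrable_fin_num => //.
  exact: integrable_gauss.
rewrite -lee_fin gE EFinM -integral_expR_tail//.
have me : measurable_fun `[s, +oo[ (fun x : R => (2 * a * x * expR (- (a * x ^+ 2)))%:E).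
  apply/measurable_EFinP/measurable_funTS; apply: measurable_funM.
    by apply: measurable_funM => //.
  apply: measurableT_comp => //; apply: measurableT_comp => //.
  by apply: measurable_funM => //; exact: measurable_funX.
have e0 (x : R) : `[s, +oo[%classic x -> (0 <= (2 * a * x * expR (- (a * x ^+ 2)))%:E)%E.
  rewrite /= in_itv/= andbT => sx.
  by rewrite lee_fin !mulr_ge0 ?expR_ge0 ?(ltW a0)// (le_trans s0).
rewrite -ge0_integralZl//; last by rewrite lee_fin ltW.
apply: (@le_trans _ _ (\int[lebesgue_measure]_(x in `[s, +oo[) (normal_pdf 0 1 x * f x)%:E)%E).
  apply: ge0_le_integral => //.
  - by move=> x sx; rewrite mule_ge0// ?lee_fin ?(ltW tc0)//; exact: e0.
  - by apply: measurable_funeM.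
  - exact: mg.
  move=> x; rewrite /= in_itv/= andbT => sx.
  rewrite -EFinM lee_fin.
  apply: (@le_trans _ _ (normal_pdf 0 1 x)); last first.
    by rewrite ler_peMr ?f1// normal_pdf_ge0.
  rewrite normal_pdf01E /tail_cst invfM.
  have -> : - (a * x ^+ 2) = - (b * x ^+ 2) - x ^+ 2 / 2 by rewrite /a; ring.
  rewrite expRD.
  have -> : 2 * a = 1 + 2 * b by rewrite /a; field.
  set P := (Num.sqrt (pi *+ 2))^-1; set E := expR (- (_ / _)).
  set S := Num.sqrt _; set B := expR _.
  have -> : S * (P * (1 + 2 * b)^-1) * ((1 + 2 * b) * x * (B * E)) = (P * E) * (S * (x * B)).
    by field; lra.
  rewrite ler_piMr ?mul_expR_sqr_le//.
  by rewrite mulr_ge0 ?expR_ge0// invr_ge0 sqrtr_ge0.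
apply: ge0_subset_integral => //; exact: mg.
Qed.

(** The integrand is s times the centered normal density of standard deviation s = 1 / sqrt (1 + 2
    b). *)
Lemma gauss_mean_expR (b : R) : 0 <= b ->
  gauss_mean (fun x => expR (- (b * x ^+ 2))) = (Num.sqrt (1 + 2 * b))^-1.
Proof.
move=> b0; set s := (Num.sqrt (1 + 2 * b))^-1.
have s0 : 0 < Num.sqrt (1 + 2 * b) by rewrite sqrtr_gt0; lra.
have sn0 : s != 0 by rewrite invr_eq0 gt_eqF.
have s2 : s ^+ 2 = (1 + 2 * b)^-1 by rewrite /s exprVn sqr_sqrtr//; lra.
transitivity (\int[lebesgue_measure]_x (normal_pdf 0 s x * s))%R; last first.
  rewrite RintegralZr//; last exact: integrable_normal_pdf.
  by rewrite /Rintegral integral_normal_pdf// mul1r.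
rewrite /gauss_mean; apply: eq_Rintegral => x _.
rewrite normal_pdf01E normal_pdfE// /normal_peak /normal_fun subr0 s2.
have -> : Num.sqrt ((1 + 2 * b)^-1 * pi *+ 2) = s * Num.sqrt (pi *+ 2).
  by rewrite -mulrnAr sqrtrM ?invr_ge0 ?sqrtrV//; lra.
rewrite -mulrA -expRD [RHS]mulrAC invfM [_ * s]mulrAC mulVf// mul1r.
congr (_ * expR _).
by field; lra.
Qed.

End gauss_mean.

(** * The Gaussian mean of bounded Lipschitz functions *)

Section euclidean.
Variable R : realType.

Definition dot n (u v : 'rV[R]_n) : R := \sum_(i < n) u 0 i * v 0 i.

Section fixed_dim.
Variable n : nat.
Implicit Types u v w : 'rV[R]_n.

Lemma dotC u v : dot u v = dot v u.
Proof. by apply: eq_bigr => i _; rewrite mulrC. Qed.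

Lemma dotDl u v w : dot (u + v) w = dot u w + dot v w.
Proof. by rewrite -big_split; apply: eq_bigr => i _; rewrite mxE mulrDl. Qed.

Lemma dotZl a u v : dot (a *: u) v = a * dot u v.
Proof. by rewrite mulr_sumr; apply: eq_bigr => i _; rewrite mxE mulrA. Qed.

Lemma dotNl u v : dot (- u) v = - dot u v.
Proof. by rewrite -scaleN1r dotZl mulN1r. Qed.

Lemma dotDr u v w : dot u (v + w) = dot u v + dot u w.
Proof. by rewrite dotC dotDl !(dotC u). Qed.

Lemma dotZr a u v : dot u (a *: v) = a * dot u v.
Proof. by rewrite dotC dotZl dotC. Qed.

Lemma dotNr u v : dot u (- v) = - dot u v.
Proof. by rewrite dotC dotNl dotC. Qed.

Lemma dot0l v : dot 0 v = 0.
Proof. by rewrite -(scale0r (0 : 'rV_n)) dotZl mul0r. Qed.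

Lemma dot_ge0 u : 0 <= dot u u.
Proof. by apply: sumr_ge0 => i _; rewrite -expr2 sqr_ge0. Qed.

Lemma dot_eq0 u : dot u u = 0 -> u = 0.
Proof.
move=> /eqP; rewrite psumr_eq0 => [/allP uu|i _]; last by rewrite -expr2 sqr_ge0.
apply/rowP => i; have := uu i (mem_index_enum i).
by rewrite mxE -expr2 sqrf_eq0 => /eqP.
Qed.

Lemma enormE u : enorm u = Num.sqrt (dot u u).
Proof. by congr Num.sqrt; apply: eq_bigr => i _; rewrite expr2. Qed.

Lemma enorm_sqr u : enorm u ^+ 2 = dot u u.
Proof. by rewrite enormE sqr_sqrtr// dot_ge0. Qed.

Lemma enorm_ge0 u : 0 <= enorm u.
Proof. exact: sqrtr_ge0. Qed.

Lemma enorm_eq0 u : enorm u = 0 -> u = 0.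
Proof. by move=> u0; apply: dot_eq0; rewrite -enorm_sqr u0 expr0n. Qed.

Lemma enorm0 : enorm (0 : 'rV[R]_n) = 0.
Proof. by rewrite enormE dot0l sqrtr0. Qed.

Lemma enormZ a u : enorm (a *: u) = `|a| * enorm u.
Proof.
by rewrite !enormE dotZl dotZr mulrA sqrtrM -?expr2 ?sqr_ge0// sqrtr_sqr.
Qed.

Lemma enormN u : enorm (- u) = enorm u.
Proof. by rewrite -scaleN1r enormZ normrN1 mul1r. Qed.

Lemma enormB u v : enorm (u - v) = enorm (v - u).
Proof. by rewrite -enormN opprB. Qed.

Lemma dot_le_enorm u v : dot u v <= enorm u * enorm v.
Proof.
have [u0|u0] := eqVneq (enorm u) 0.
  by rewrite u0 mul0r (enorm_eq0 u0) dot0l.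
have [v0|v0] := eqVneq (enorm v) 0.
  by rewrite v0 mulr0 (enorm_eq0 v0) dotC dot0l.
have uv0 : 0 < enorm u * enorm v by rewrite mulr_gt0// lt_def ?u0 ?v0 enorm_ge0.
have := dot_ge0 (enorm v *: u - enorm u *: v).
rewrite dotDl !dotDr !dotNl !dotNr !dotZl !dotZr -!enorm_sqr (dotC v u).
move=> h; rewrite -(ler_pM2l uv0); move: h.
set A := enorm u; set B := enorm v; set D := dot u v; lra.
Qed.

Lemma enorm_triangle u v : enorm (u + v) <= enorm u + enorm v.
Proof.
rewrite -ler_sqr ?nnegrE ?addr_ge0 ?enorm_ge0//.
rewrite enorm_sqr dotDl !dotDr (dotC v u) sqrrD !enorm_sqr.
have := dot_le_enorm u v; lra.
Qed.

Lemma normr_dot_le u v : `|dot u v| <= enorm u * enorm v.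
Proof.
rewrite ler_norml dot_le_enorm andbT lerNl -dotNl.
by rewrite (le_trans (dot_le_enorm _ _))// enormN.
Qed.

End fixed_dim.

Section snoc.
Variable n : nat.
Implicit Types y z : 'rV[R]_n.

(** The last coordinate is singled out because [gaussE] integrates it first and because it carries
    the axis of the circular cone. *)
Definition snoc y (x : R) : 'rV[R]_n.+1 :=
  \row_i oapp (y 0) x (unlift ord_max i).

Definition belast_row (v : 'rV[R]_n.+1) : 'rV[R]_n := \row_j v 0 (lift ord_max j).

Lemma snocK v : snoc (belast_row v) (v 0 ord_max) = v.
Proof.
by apply/rowP => i; rewrite mxE; case: unliftP => [j|] -> //=; rewrite mxE.
Qed.

Lemma snocD y z a b : snoc y a + snoc z b = snoc (y + z) (a + b).
Proof. by apply/rowP => i; rewrite !mxE; case: unlift => //= j; rewrite mxE. Qed.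

Lemma snocZ k y a : k *: snoc y a = snoc (k *: y) (k * a).
Proof. by apply/rowP => i; rewrite !mxE; case: unlift => //= j; rewrite mxE. Qed.

Lemma snocN y a : - snoc y a = snoc (- y) (- a).
Proof. by rewrite -scaleN1r snocZ scaleN1r mulN1r. Qed.

Lemma dot_snoc y z a b : dot (snoc y a) (snoc z b) = dot y z + a * b.
Proof.
rewrite /dot big_ord_recr /= !mxE unlift_none /=; congr (_ + _).
apply: eq_bigr => i _; rewrite !mxE.
have -> : widen_ord (leqnSn n) i = lift ord_max i by apply/val_inj/esym/lift_max.
by rewrite liftK.
Qed.

Lemma enorm_snoc y a : enorm (snoc y a) = Num.sqrt (enorm y ^+ 2 + a ^+ 2).
Proof. by rewrite enormE dot_snoc enorm_sqr expr2. Qed.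

Lemma enorm_snoc0 y : enorm (snoc y 0) = enorm y.
Proof. by rewrite enorm_snoc expr0n addr0 sqrtr_sqr ger0_norm// enorm_ge0. Qed.

Lemma enorm_0snoc a : enorm (snoc 0 a) = `|a|.
Proof. by rewrite enorm_snoc enorm0 expr0n add0r sqrtr_sqr. Qed.

End snoc.

(** Integrating out one coordinate preserves this class, with the same two constants
    ([blip_gauss_mean]), so measurability and integrability are available at every stage of the
    iterated integral. *)
Definition blip n (f : 'rV[R]_n -> R) :=
  (exists B, forall v, `|f v| <= B) /\
  (exists L, forall v w, `|f v - f w| <= L * enorm (v - w)).

Lemma lipschitz_continuous (V : normedModType R) (g : V -> R) (L : R) :
  (forall p q, `|g p - g q| <= L * `|p - q|) -> continuous g.
Proof.
move=> gL p; apply/cvgrPdist_le => e e0.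
near=> q; rewrite (le_trans (gL p q))//.
apply: (@le_trans _ _ ((`|L| + 1) * `|p - q|)).
  by rewrite ler_wpM2r// (le_trans (ler_norm L))// lerDl.
rewrite -ler_pdivlMl ?ltr_wpDl//.
near: q; apply: cvgr_dist_le; first exact: cvg_id.
by rewrite mulr_gt0// invr_gt0 ltr_wpDl.
Unshelve. all: by end_near. Qed.

Section blip_theory.
Variable n : nat.
Implicit Types f : 'rV[R]_n.+1 -> R.

Lemma blip_snoc_continuous f y : blip f -> continuous (fun x => f (snoc y x)).
Proof.
move=> [_ [L fL]]; apply: (@lipschitz_continuous R^o _ L) => a b.
by rewrite (le_trans (fL _ _))// snocN snocD subrr enorm_0snoc.
Qed.

Lemma blip_snoc_measurable f y : blip f ->
  measurable_fun setT (fun x => f (snoc y x)).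
Proof. by move=> bf; apply: continuous_measurable_fun; exact: blip_snoc_continuous. Qed.

Lemma blip_snoc_bounded f y : blip f -> bounded_fun1 (fun x => f (snoc y x)).
Proof. by move=> [[B fB] _]; exists B. Qed.

Lemma gauss_mean_normr_le (g : R -> R) (B : R) : measurable_fun setT g ->
  (forall x, `|g x| <= B) -> `|gauss_mean g| <= B.
Proof.
move=> mg gB; have bc (k : R) : bounded_fun1 (fun _ : R => k) by exists `|k|.
have bg : bounded_fun1 g by exists B.
rewrite ler_norml -{2}(gauss_mean_cst B) -(gauss_mean_cst (- B)).
apply/andP; split; apply: le_gauss_mean => // x;
  by have := gB x; rewrite ler_norml => /andP[].
Qed.

Lemma blip_gauss_mean f : blip f -> blip (fun y => gauss_mean (fun x => f (snoc y x))).
Proof.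
move=> bf; have [[B fB] [L fL]] := bf; split.
  exists B => y; apply: gauss_mean_normr_le => //; exact: blip_snoc_measurable.
exists L => y z.
have mN : measurable_fun setT (fun x => - 1 * f (snoc z x)).
  by apply: measurable_funM => //; exact: blip_snoc_measurable.
rewrite -[X in _ - X]mul1r -mulNr -gauss_meanZ; first last.
- exact: blip_snoc_bounded.
- exact: blip_snoc_measurable.
rewrite -gauss_meanD//; first last.
- by exists B => x; rewrite normrM normrN1 mul1r.
- exact: blip_snoc_bounded.
- exact: blip_snoc_measurable.
apply: gauss_mean_normr_le.
  by apply: measurable_funD => //; exact: blip_snoc_measurable.
move=> x; rewrite mulN1r (le_trans (fL _ _))//.
by rewrite snocN snocD subrr enorm_snoc0.
Qed.

End blip_theory.

Lemma blip_add n (f g : 'rV[R]_n -> R) : blip f -> blip g -> blip (fun v => f v + g v).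
Proof.
move=> [[B fB] [L fL]] [[B' gB] [L' gL]]; split.
  by exists (B + B') => v; rewrite (le_trans (ler_normD _ _))// lerD.
exists (L + L') => v w; rewrite opprD addrACA mulrDl.
by rewrite (le_trans (ler_normD _ _))// lerD.
Qed.

Lemma blip_cst n (k : R) : blip (fun _ : 'rV[R]_n => k).
Proof. split; first by exists `|k|.
by exists 0 => v w; rewrite subrr normr0 mul0r. Qed.

Lemma blip_sum n (J : Type) (r : seq J) (P : pred J) (f : J -> 'rV[R]_n -> R) :
  (forall j, blip (f j)) -> blip (fun v => \sum_(j <- r | P j) f j v).
Proof.
move=> bf; elim: r => [|j r IH].
  by under eq_fun do rewrite big_nil; exact: blip_cst.
under eq_fun do rewrite big_cons.
by case: (P j) => //; exact: blip_add.
Qed.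

Lemma blip_comp_isometry n (f : 'rV[R]_n -> R) (H : 'rV[R]_n -> 'rV[R]_n) :
  blip f -> (forall v w, enorm (H v - H w) = enorm (v - w)) -> blip (f \o H).
Proof.
move=> [[B fB] [L fL]] iH; split; first by exists B => v; exact: fB.
by exists L => v w; rewrite -iH; exact: fL.
Qed.

Fixpoint gaussE n : ('rV[R]_n -> R) -> R :=
  if n is n'.+1 then
    fun f => gaussE (fun y => gauss_mean (fun x => f (snoc y x)))
  else fun f => f 0.

Lemma gaussE_cst n (k : R) : gaussE (fun _ : 'rV[R]_n => k) = k.
Proof.
by elim: n => [//|n IH] /=; under eq_fun do rewrite gauss_mean_cst.
Qed.

Lemma le_gaussE n (f g : 'rV[R]_n -> R) : blip f -> blip g ->
  (forall v, f v <= g v) -> gaussE f <= gaussE g.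
Proof.
elim: n f g => [|n IH] f g bf bg fg /=; first exact: fg.
apply: IH => [||y]; do ?exact: blip_gauss_mean.
by apply: le_gauss_mean => //; do ?[exact: blip_snoc_measurable|exact: blip_snoc_bounded].
Qed.

Lemma gaussED n (f g : 'rV[R]_n -> R) : blip f -> blip g ->
  gaussE (fun v => f v + g v) = gaussE f + gaussE g.
Proof.
elim: n f g => [|n IH] f g bf bg //=.
rewrite -IH; do ?exact: blip_gauss_mean.
congr gaussE; apply/funext => y.
by apply: gauss_meanD => //; do ?[exact: blip_snoc_measurable|exact: blip_snoc_bounded].
Qed.

Lemma gaussE_sum n (J : Type) (r : seq J) (P : pred J) (f : J -> 'rV[R]_n -> R) :
  (forall j, blip (f j)) ->
  gaussE (fun v => \sum_(j <- r | P j) f j v) = \sum_(j <- r | P j) gaussE (f j).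
Proof.
move=> bf; elim: r => [|j r IH].
  by rewrite big_nil; under eq_fun do rewrite big_nil; exact: gaussE_cst.
rewrite big_cons; under eq_fun do rewrite big_cons.
by case: (P j) => //; rewrite gaussED ?IH//; exact: blip_sum.
Qed.

Lemma gaussEN n (f : 'rV[R]_n -> R) : blip f -> (forall v, 0 <= f v) ->
  gaussE (fun v => f (- v)) = gaussE f.
Proof.
elim: n f => [|n IH] f bf f0 /=; first by rewrite oppr0.
rewrite -[RHS]IH; first last.
- move=> y; rewrite -(gauss_mean_cst 0); apply: le_gauss_mean => //.
  + by exists 0 => x; rewrite normr0.
  + exact: blip_snoc_measurable.
  + exact: blip_snoc_bounded.
- exact: blip_gauss_mean.
congr gaussE; apply/funext => y.
rewrite -[RHS]gauss_meanN//; last exact: blip_snoc_continuous.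
by congr gauss_mean; apply/funext => x; rewrite snocN.
Qed.

(* The hypothesis is only an inequality so that the bound itself need not be
   Lipschitz. *)
Lemma gaussE_ge_expR n (f : 'rV[R]_n -> R) (K b : R) : blip f ->
  0 <= b -> (forall v, K * expR (- (b * enorm v ^+ 2)) <= f v) ->
  K * (Num.sqrt (1 + 2 * b))^-1 ^+ n <= gaussE f.
Proof.
elim: n f K => [|n IH] f K bf b0 fK /=.
  by have := fK 0; rewrite enorm0 !expr0n mulr0 oppr0 expR0.
rewrite exprS mulrA; apply: IH => //; first exact: blip_gauss_mean.
move=> y; set E := expR _.
have m1 : measurable_fun [set: R] (fun x : R => expR (- (b * x ^+ 2))).
  apply: measurableT_comp => //; apply: measurableT_comp => //.
  by apply: measurable_funM => //; exact: measurable_funX.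
have b1 : bounded_fun1 (fun x : R => expR (- (b * x ^+ 2))).
  exists 1 => x; rewrite ger0_norm ?expR_ge0//.
  by rewrite expR_le1 oppr_le0 mulr_ge0// sqr_ge0.
rewrite mulrAC -gauss_mean_expR// -gauss_meanZ//.
apply: le_gauss_mean => //.
- by apply: measurable_funM.
- have [B Bb] := b1; exists (`|K * E| * B) => x.
  by rewrite normrM ler_wpM2l.
- exact: blip_snoc_measurable.
- exact: blip_snoc_bounded.
move=> x; rewrite (le_trans _ (fK _))// enorm_snoc sqr_sqrtr; last first.
  by rewrite addr_ge0 ?sqr_ge0.
by rewrite -mulrA -expRD -opprD -mulrDr.
Qed.

End euclidean.

(** * Rotation invariance of the Gaussian mean *)

Section gaussE_isometry.
Variable R : realType.

Lemma gauss_mean2_plane (g : R * R -> R) : continuous g ->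
  (exists B, forall p, `|g p| <= B) -> (forall p, 0 <= g p) ->
  (gauss_mean (fun a => gauss_mean (fun b => g (a, b))))%:E =
  plane_integral (fun p => normal_pdf 0 1 p.1 * normal_pdf 0 1 p.2 * g p).
Proof.
move=> cg [B gB] g0.
have m1 a : measurable_fun setT (fun b => g (a, b)).
  by apply: continuous_measurable_fun; exact: continuous_curry1.
have b1 a : bounded_fun1 (fun b => g (a, b)) by exists B.
have m2 : measurable_fun setT
    (fun a => \int[lebesgue_measure]_b (normal_pdf 0 1 b * g (a, b))%:E)%E.
  apply: (@measurable_fun_fubini_tonelli_F _ _ (measurableTypeR R) (measurableTypeR R)
    R lebesgue_measure (fun p => (normal_pdf 0 1 p.2 * g p)%:E)) => [|p].
    apply/measurable_EFinP; apply: measurable_funM.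
      by apply: measurableT_comp => //; exact: measurable_normal_pdf.
    exact: continuous2_measurable_fun.
  by rewrite lee_fin mulr_ge0// normal_pdf_ge0.
have inner a : (gauss_mean (fun b => g (a, b)))%:E =
    (\int[lebesgue_measure]_b (normal_pdf 0 1 b * g (a, b))%:E)%E.
  by rewrite fineK//; apply: integrable_fin_num => //; exact: integrable_gauss.
have m3 : measurable_fun setT (fun a => gauss_mean (fun b => g (a, b))).
  apply/measurable_EFinP; apply: eq_measurable_fun m2 => a _.
  exact/esym/inner.
have b3 : bounded_fun1 (fun a => gauss_mean (fun b => g (a, b))).
  by exists B => a; exact: gauss_mean_normr_le.
rewrite fineK; last first.
  by apply: integrable_fin_num => //; exact: integrable_gauss.
apply: eq_integral => a _.
rewrite EFinM inner -ge0_integralZl//=.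
- apply: eq_integral => b bT /=; by rewrite -EFinM mulrA.
- apply/measurable_EFinP; apply: measurable_funM; last exact: m1.
  exact: measurable_normal_pdf.
- by move=> b _; rewrite lee_fin mulr_ge0// normal_pdf_ge0.
- by rewrite lee_fin normal_pdf_ge0.
Qed.

Lemma gauss_mean2_rot (g : R * R -> R) (L c s : R) :
  (forall p q, `|g p - g q| <= L * `|p - q|) ->
  (exists B, forall p, `|g p| <= B) -> (forall p, 0 <= g p) ->
  c ^+ 2 + s ^+ 2 = 1 ->
  gauss_mean (fun a => gauss_mean (fun b => g (c * a + s * b, - s * a + c * b))) =
  gauss_mean (fun a => gauss_mean (fun b => g (a, b))).
Proof.
move=> gL bg g0 cs.
have cg := lipschitz_continuous gL.
(* Here the rotation is the identity or -id. The second is not reached by the shears and is obtained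
   by reflecting each variable separately. *)
have [s0|s0] := eqVneq s 0.
  have : (c - 1) * (c + 1) = 0 by rewrite -subr_sqr expr1n -cs s0; ring.
  move=> /eqP; rewrite mulf_eq0 subr_eq0 addr_eq0 => /orP[] /eqP ->; rewrite s0.
    congr gauss_mean; apply/funext => a; congr gauss_mean; apply/funext => b.
    by congr (g (_, _)); ring.
  have [B gB] := bg.
  pose G a := gauss_mean (fun b => g (a, b)).
  have mc a : measurable_fun setT (fun b => g (a, b)).
    by apply: continuous_measurable_fun; exact: continuous_curry1.
  have G0 a : 0 <= G a.
    rewrite -(gauss_mean_cst 0); apply: le_gauss_mean => //; last by exists B.
    by exists 0 => x; rewrite normr0.
  have cG : continuous G.
    apply: (@lipschitz_continuous R R^o _ L) => a a'.
    rewrite -[X in _ - X]mul1r -mulNr -gauss_meanZ//; last by exists B.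
    rewrite -gauss_meanD//; first last.
    - by exists B => x; rewrite normrM normrN1 mul1r.
    - exact: measurable_funM.
    - by exists B.
    apply: gauss_mean_normr_le.
      by apply: measurable_funD => //; exact: measurable_funM.
    move=> x; rewrite mulN1r (le_trans (gL _ _))//.
    rewrite (_ : (a, x) - (a', x) = (a - a', 0)); last by congr pair; exact: subrr.
    by rewrite prod_normE /= normr0 max_l.
  rewrite -(gauss_meanN cG G0); congr gauss_mean; apply/funext => a.
  rewrite /G -[RHS]gauss_meanN//; last exact: continuous_curry1.
  by congr gauss_mean; apply/funext => b; congr (g (_, _)); ring.
have cpdf : continuous (normal_pdf 0 1 : R -> R) by exact: continuous_normal_pdf.
pose h (p : R * R) := normal_pdf 0 1 p.1 * normal_pdf 0 1 p.2 * g p.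
have ch : continuous h.
  move=> p; apply: cvgM; last exact: cg.
  apply: cvgM.
    by apply: (@continuous_comp _ _ _ fst); [exact: cvg_fst|exact: cpdf].
  by apply: (@continuous_comp _ _ _ snd); [exact: cvg_snd|exact: cpdf].
have h0 p : 0 <= h p by rewrite mulr_ge0// mulr_ge0// normal_pdf_ge0.
pose g' p := g (c * p.1 + s * p.2, - s * p.1 + c * p.2).
have cg' : continuous g' by apply: continuous_pair_comp => //; exact: continuous_lin2.
have bg' : exists B, forall p, `|g' p| <= B by have [B gB] := bg; exists B => p; exact: gB.
apply/EFin_inj; apply: (etrans (gauss_mean2_plane cg' bg' _)) => [p|]; first exact: g0.
apply: etrans (esym (gauss_mean2_plane cg bg g0)).
apply: etrans (plane_integral_rot ch h0 cs s0).
congr plane_integral; apply/funext => -[a b]; rewrite /g' /h /=; congr (_ * _).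
rewrite !normal_pdf01E ![(_ * expR _) * _]mulrACA -!expRD; congr (_ * expR _).
have -> : a ^+ 2 / 2 = a ^+ 2 * (c ^+ 2 + s ^+ 2) / 2 by rewrite cs mulr1.
have -> : b ^+ 2 / 2 = b ^+ 2 * (c ^+ 2 + s ^+ 2) / 2 by rewrite cs mulr1.
by field.
Qed.

Lemma gaussE2 n (f : 'rV[R]_n.+2 -> R) :
  gaussE f = gaussE (fun y =>
    gauss_mean (fun a => gauss_mean (fun b => f (snoc (snoc y a) b)))).
Proof. by []. Qed.

Definition linear_isometry n (H : 'rV[R]_n -> 'rV[R]_n) :=
  (forall a v w, H (a *: v + w) = a *: H v + H w) /\
  (forall v, enorm (H v) = enorm v).

Lemma linear_isometryB n (H : 'rV[R]_n -> 'rV[R]_n) : linear_isometry H ->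
  forall v w, enorm (H v - H w) = enorm (v - w).
Proof.
move=> [lH iH] v w; rewrite -[in RHS]iH; congr enorm.
by rewrite -(scaleN1r w) (addrC v) lH scaleN1r addrC.
Qed.

Lemma linear_isometryZ n (H : 'rV[R]_n -> 'rV[R]_n) : linear_isometry H ->
  forall a v, H (a *: v) = a *: H v.
Proof.
move=> [lH _] a v; have H0 : H 0 = 0.
  by have := lH (-1) 0 0; rewrite scaleN1r oppr0 addr0 scaleN1r addNr.
by have := lH a v 0; rewrite H0 !addr0.
Qed.

(* The isometry is built one coordinate at a time, as a product of rotations
   in coordinate planes. *)
Lemma gaussE_isometry n (u : 'rV[R]_n.+1) : enorm u = 1 ->
  exists H : 'rV[R]_n.+1 -> 'rV[R]_n.+1,
    [/\ linear_isometry H, H (snoc 0 1) = u &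
     forall f, blip f -> (forall v, 0 <= f v) -> gaussE (f \o H) = gaussE f].
Proof.
elim: n u => [|n IH] u u1.
  set q := u 0 ord_max.
  have uE : u = snoc 0 q.
    by rewrite -[LHS]snocK; congr snoc; apply/rowP => -[].
  have : `|q| = 1 by rewrite -u1 uE enorm_0snoc.
  move=> /eqP; rewrite eqr_norml ler01 andbT => /orP[] /eqP q1.
    exists id; split => //.
    by rewrite [RHS]uE q1.
  exists -%R; split.
  - by split=> [a v w|v]; rewrite ?enormN// opprD scalerN.
  - by rewrite [RHS]uE q1 snocN oppr0.
  - by move=> f bf f0; exact: gaussEN.
set q := u 0 ord_max; set u' := belast_row u; set p := enorm u'.
have uE : u = snoc u' q by rewrite -[LHS]snocK.
have qp : q ^+ 2 + p ^+ 2 = 1.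
  have : enorm u ^+ 2 = 1 by rewrite u1 expr1n.
  by rewrite uE enorm_snoc sqr_sqrtr 1?addrC// addr_ge0// sqr_ge0.
(* The direction of [u']; when [u'] vanishes any unit vector does, since only [p *: w = u'] is
   used. *)
pose w : 'rV[R]_n.+1 := if p == 0 then snoc 0 1 else p^-1 *: u'.
have w1 : enorm w = 1.
  rewrite /w; case: eqVneq => [_|p0]; first by rewrite enorm_0snoc normr1.
  by rewrite enormZ ger0_norm ?invr_ge0 ?enorm_ge0// mulVf.
have pw : p *: w = u'.
  rewrite /w; case: eqVneq => [p0|p0]; last by rewrite scalerA divff// scale1r.
  by rewrite p0 scale0r [RHS]enorm_eq0.
have [H' [isoH' H'e EH']] := IH w w1.
have [lH' iH'] := isoH'.
have snocP m (v : 'rV[R]_m.+1) : exists y a, v = snoc y a.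
  by exists (belast_row v), (v 0 ord_max); rewrite snocK.
(* The rotation [rot] of the last two coordinates sends the last basis vector to p times the
   previous one plus q times itself; [ext] then turns that previous basis vector into [w], which
   yields [u]. *)
pose rot (v : 'rV[R]_n.+2) :=
  let y := belast_row (belast_row v) in
  let a := belast_row v 0 ord_max in let b := v 0 ord_max in
  snoc (snoc y (q * a + p * b)) (- p * a + q * b).
have belastE m (y : 'rV[R]_m) a : belast_row (snoc y a) = y.
  by apply/rowP => i; rewrite !mxE liftK.
have lastE m (y : 'rV[R]_m) a : snoc y a 0 ord_max = a.
  by rewrite mxE unlift_none.
have rotE y a b : rot (snoc (snoc y a) b) =
    snoc (snoc y (q * a + p * b)) (- p * a + q * b).
  by rewrite /rot !belastE !lastE.
pose ext (v : 'rV[R]_n.+2) := snoc (H' (belast_row v)) (v 0 ord_max).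
have extE y a : ext (snoc y a) = snoc (H' y) a by rewrite /ext belastE lastE.
have iso_rot : linear_isometry rot.
  split=> [k v z|v].
    have [v' [b ->]] := snocP _ v; have [y [a ->]] := snocP _ v'.
    have [z' [d ->]] := snocP _ z; have [x [e ->]] := snocP _ z'.
    rewrite !rotE !snocZ !snocD !rotE.
    by congr (snoc (snoc _ _) _); ring.
  have [v' [b ->]] := snocP _ v; have [y [a ->]] := snocP _ v'.
  rewrite rotE !enorm_snoc !sqr_sqrtr; do ?[exact: sqr_ge0|apply: addr_ge0|apply: sumr_ge0 => ? _].
  congr Num.sqrt; rewrite -!addrA; congr (_ + _).
  transitivity ((q ^+ 2 + p ^+ 2) * (a ^+ 2 + b ^+ 2)); first by ring.
  by rewrite qp mul1r.
have iso_ext : linear_isometry ext.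
  split=> [k v z|v].
    have [y [a ->]] := snocP _ v; have [x [b ->]] := snocP _ z.
    rewrite !extE !snocZ !snocD !extE.
    by rewrite lH'.
  by have [y [a ->]] := snocP _ v; rewrite extE !enorm_snoc iH'.
exists (ext \o rot); split.
- split=> [k v z|v] /=; last by rewrite iso_ext.2 iso_rot.2.
  by rewrite iso_rot.1 iso_ext.1.
- rewrite /= -[X in rot (snoc X _)](_ : snoc 0 0 = 0); last first.
    by apply/rowP => i; rewrite !mxE; case: unlift => //= j; rewrite mxE.
  rewrite rotE extE uE; congr snoc; last by ring.
  rewrite !mulr0 !mulr1 add0r -pw -H'e -(linear_isometryZ isoH').
  by congr H'; rewrite snocZ scaler0 mulr1.
move=> f bf f0.
have bfe : blip (f \o ext) := blip_comp_isometry bf (linear_isometryB iso_ext).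
transitivity (gaussE (f \o ext)).
  rewrite !gaussE2; apply: (congr1 (@gaussE R n)); apply/funext => y.
  pose g (ab : R * R) := (f \o ext) (snoc (snoc y ab.1) ab.2).
  transitivity (gauss_mean (fun a => gauss_mean (fun b =>
      g (q * a + p * b, - p * a + q * b)))).
    congr gauss_mean; apply/funext => a; congr gauss_mean; apply/funext => b.
    by rewrite /g /= rotE.
  have [[B fB] [L fL]] := bfe.
  (* The norm of the product [R * R] is the sup norm, and sqrt (A^2 + B^2) <= 2 max (A, B). *)
  apply: (@gauss_mean2_rot g (`|L| * 2)) => [|||//]; last 2 first.
  - by exists B => ab; exact: fB.
  - by move=> ab; exact: f0.
  move=> [a b] [a' b'] /=; apply: (le_trans (fL _ _)).
  apply: (@le_trans _ _ (`|L| * enorm (snoc (snoc y a) b - snoc (snoc y a') b'))).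
    by rewrite ler_wpM2r ?enorm_ge0// ler_norm.
  rewrite -mulrA ler_wpM2l// !snocN !snocD subrr.
  rewrite -[leRHS]ger0_norm ?mulr_ge0// -sqrtr_sqr enorm_snoc enorm_0snoc.
  rewrite ler_sqrt ?sqr_ge0// prod_normE /=.
  set M := Num.max _ _; rewrite -[leLHS]addr0.
  have Ma : `|a - a'| <= M by rewrite le_max lexx.
  have Mb : `|b - b'| <= M by rewrite le_max lexx orbT.
  rewrite addr0 -(real_normK (num_real (b - b'))).
  have := normr_ge0 (a - a'); have := normr_ge0 (b - b'); nra.
apply: (etrans _ (EH' _ (blip_gauss_mean bf) _)) => [|y].
  apply: (congr1 (@gaussE R n.+1)); apply/funext => y.
  apply: (congr1 (@gauss_mean R)); apply/funext => x.
  by rewrite [LHS]/= extE.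
rewrite -(gauss_mean_cst 0); apply: le_gauss_mean => //.
- by exists 0 => x; rewrite normr0.
- exact: blip_snoc_measurable.
- exact: blip_snoc_bounded.
Qed.

End gaussE_isometry.

(** * The Gaussian measure of a polar cone *)

Section polar_cone.
Variable R : realType.

(** The convex hull, generated by moving from a point already reached towards a point of [F]. Bounds
    that are convex in [m] propagate by induction, and this step is exactly the variation used in
    [approx_center]. *)
Inductive hull n (F : set 'rV[R]_n) : 'rV[R]_n -> Prop :=
| hull_base f : F f -> hull F f
| hull_step m f (s : R) : hull F m -> F f -> 0 <= s <= 1 ->
    hull F ((1 - s) *: m + s *: f).

Section center.
Variables (n : nat) (F : set 'rV[R]_n) (D : R).
Hypothesis F1 : forall f, F f -> enorm f = 1.
Hypothesis FD : forall f g, F f -> F g -> enorm (f - g) <= D.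

(** For unit vectors |f - g|^2 = 2 - 2 <f, g>, so distance at most [D] means inner product at least
    [kappa]. *)
Let kappa := 1 - D ^+ 2 / 2.

Lemma dot_unit_ge f g : F f -> F g -> kappa <= dot f g.
Proof.
move=> Ff Fg; have fgD := FD Ff Fg.
have : enorm (f - g) ^+ 2 <= D ^+ 2.
  by rewrite ler_sqr ?nnegrE ?enorm_ge0// (le_trans _ fgD)// enorm_ge0.
rewrite enorm_sqr dotDl !dotDr !dotNl !dotNr (dotC g f) -!enorm_sqr !F1//.
by rewrite /kappa; lra.
Qed.

Lemma dot_hull_unit_ge m f : hull F m -> F f -> kappa <= dot m f.
Proof.
move=> hm Ff; elim: hm => [g Fg|m' g s _ IH Fg /andP[s0 s1]].
  exact: dot_unit_ge.
rewrite dotDl !dotZl; have := dot_unit_ge Fg Ff; nra.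
Qed.

Lemma dot_hull_ge m m' : hull F m -> hull F m' -> kappa <= dot m m'.
Proof.
move=> hm; elim=> [g Fg|m1 g s _ IH Fg /andP[s0 s1]].
  exact: dot_hull_unit_ge.
rewrite dotDr !dotZr; have := dot_hull_unit_ge hm Fg; nra.
Qed.

Lemma enorm_hull_le m : hull F m -> enorm m <= 1.
Proof.
elim=> [g Fg|m1 g s _ IH Fg /andP[s0 s1]]; first by rewrite F1.
rewrite (le_trans (enorm_triangle _ _))// !enormZ (F1 Fg) !ger0_norm ?subr_ge0//.
by have := enorm_ge0 m1; nra.
Qed.

(* The direction of an almost shortest point of the convex hull. *)
Lemma approx_center (c : R) : F !=set0 -> 0 < c -> c ^+ 2 < kappa ->
  exists2 u, enorm u = 1 & forall f, F f -> c <= dot u f.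
Proof.
move=> [f0 Ff0] c0 ck; pose k := Num.sqrt kappa.
have kappa0 : 0 < kappa by apply: le_lt_trans ck; exact: sqr_ge0.
have k0 : 0 < k by rewrite sqrtr_gt0.
have k2 : k ^+ 2 = kappa by rewrite sqr_sqrtr// ltW.
have ck' : c < k by rewrite -ltr_sqr ?nnegrE ?(ltW c0) ?(ltW k0)// k2.
(* Let |m|^2 be within s^2 of the infimum. Moving from [m] towards [f] by the fraction [s] cannot
   lower |m|^2 by s^2 or more, which forces <m, f> >= |m|^2 - 3 s / 2. As 3 s / 2 <= k (k - c) <=
   |m|^2 - c |m|, this is at least c |m|. *)
pose s := Num.min 2^-1 (k * (k - c) / 2).
have s0 : 0 < s by rewrite lt_min invr_gt0 ltr0n divr_gt0// mulr_gt0// subr_gt0.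
have s1 : s <= 2^-1 by rewrite ge_min lexx.
have s2 : s <= k * (k - c) / 2 by rewrite ge_min lexx orbT.
pose S := [set dot m m | m in hull F].
have hS : has_inf S.
  split; first by exists (dot f0 f0), f0 => //; exact: hull_base.
  by exists kappa => _ [m hm <-]; exact: dot_hull_ge.
have [_ [m hm <-] mI] := inf_adherent (exprn_gt0 2 s0) hS.
have Sle m' : hull F m' -> inf S <= dot m' m'.
  by move=> hm'; apply: ge_inf; [exact: hS.2|exists m'].
set A := enorm m.
have Ak : k <= A.
  rewrite -ler_sqr ?nnegrE ?enorm_ge0 ?(ltW k0)// k2 enorm_sqr.
  exact: dot_hull_ge.
have A0 : 0 < A by exact: lt_le_trans Ak.
have A1 : A <= 1 by exact: enorm_hull_le.
exists (A^-1 *: m) => [|f Ff].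
  by rewrite enormZ ger0_norm ?invr_ge0 ?enorm_ge0// mulVf// gt_eqF.
rewrite dotZl mulrC ler_pdivlMr//.
have := Sle _ (hull_step hm Ff (s := s) _).
rewrite dotDl !dotDr !dotZl !dotZr (dotC f m) -!enorm_sqr (F1 Ff) -/A expr1n.
have Bk := dot_hull_unit_ge hm Ff.
move: mI; rewrite -enorm_sqr -/A; move: (inf S) => I mI.
set B := dot m f in Bk *.
have -> : 0 <= s <= 1 by apply/andP; split; lra.
move=> /(_ isT) h.
have h1 : A ^+ 2 - 3 / 2 * s <= B.
  rewrite -(ler_pM2l s0).
  have B0 : 0 <= B by rewrite (le_trans (ltW kappa0)).
  have sB : 0 <= s ^+ 2 * B by rewrite mulr_ge0// sqr_ge0.
  have sA : s ^+ 2 * A ^+ 2 <= s ^+ 2.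
    by rewrite ler_piMr ?sqr_ge0// expr_le1// ltW.
  lra.
have : c * A <= A ^+ 2 - k * (k - c).
  have : 0 <= (A - k) * (A + k - c) by rewrite mulr_ge0//; lra.
  lra.
lra.
Qed.

End center.

(** Where it is positive, [v] lies in the polar cone of [F]. For unit vectors it is 1-Lipschitz in
    [v], so a clamped multiple of it can stand for the indicator of that cone. *)
Definition inf_dot n (F : set 'rV[R]_n) (v : 'rV[R]_n) : R := inf [set dot v f | f in F].

Section inf_dot.
Variables (n : nat) (F : set 'rV[R]_n).
Hypothesis F0 : F !=set0.
Hypothesis F1 : forall f, F f -> enorm f = 1.

Lemma inf_dot_le v f : F f -> inf_dot F v <= dot v f.
Proof.
move=> Ff; apply: ge_inf; last by exists f.
exists (- enorm v) => _ [g Fg <-].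
have := normr_dot_le v g; rewrite (F1 Fg) mulr1 ler_norml => /andP[//].
Qed.

Lemma le_inf_dot v a : (forall f, F f -> a <= dot v f) -> a <= inf_dot F v.
Proof.
move=> aF; apply: lb_le_inf; last by move=> _ [f Ff <-]; exact: aF.
by have [f Ff] := F0; exists (dot v f), f.
Qed.

Lemma inf_dot_lipschitz v w : `|inf_dot F v - inf_dot F w| <= enorm (v - w).
Proof.
have H v' w' : inf_dot F v' - enorm (v' - w') <= inf_dot F w'.
  apply: le_inf_dot => f Ff; rewrite lerBlDr.
  apply: (le_trans (inf_dot_le v' Ff)); rewrite -lerBlDl -dotNl -dotDl.
  by rewrite (le_trans (dot_le_enorm _ _))// (F1 Ff) mulr1.
have := H v w; have := H w v; rewrite (enormB w v) ler_norml.
by move=> ? ?; apply/andP; split; lra.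
Qed.

End inf_dot.

Definition clamp (x : R) := Num.min 1 (Num.max 0 x).

Lemma clamp_ge0 x : 0 <= clamp x.
Proof. by rewrite le_min ler01 le_max lexx. Qed.

Lemma clamp_le1 x : clamp x <= 1.
Proof. by rewrite ge_min lexx. Qed.

Lemma clamp_lipschitz x y : `|clamp x - clamp y| <= `|x - y|.
Proof.
have H z w : clamp z <= clamp w + `|z - w|.
  rewrite -lerBlDr le_min; apply/andP; split.
    by rewrite lerBlDr (le_trans (clamp_le1 z))// lerDl.
  rewrite lerBlDr; apply: (@le_trans _ _ (Num.max 0 z)).
    by rewrite ge_min lexx orbT.
  rewrite ge_max addr_ge0 ?le_max ?lexx//=.
  rewrite -lerBlDr le_max; apply/orP; right.
  by have := ler_norm (z - w); lra.
have := H x y; have := H y x; rewrite distrC => h1 h2.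
by rewrite ler_norml; apply/andP; split; lra.
Qed.

Lemma clamp_gt0 x : 0 < clamp x -> 0 < x.
Proof. by rewrite lt_min lt_max ltxx => /andP[]. Qed.

Lemma clamp_eq1 x : 1 <= x -> clamp x = 1.
Proof. by move=> x1; rewrite /clamp max_r ?min_l// (le_trans ler01). Qed.

(** Integrating the tail bound at height |y| / tau over the n coordinates of y gives one factor 1 /
    sqrt (1 + 2 (1/2 + b) / tau^2) for each. The half is lost to the reflection. *)
Definition cone_prob n (tau b : R) : R :=
  tail_cst b / 2 * (Num.sqrt (1 + 2 * ((2^-1 + b) / tau ^+ 2)))^-1 ^+ n.

(* Schramm's argument: the polar cone of [F] and its mirror image in the axis
   through the center [u] of [F] together cover the circular cone of axis [u]
   and slope [tau]. *)
Lemma gaussE_polar n (F : set 'rV[R]_n.+1) (D tau b p : R) :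
  F !=set0 -> (forall f, F f -> enorm f = 1) ->
  (forall f g, F f -> F g -> enorm (f - g) <= D) ->
  0 < tau -> (tau * D) ^+ 2 < 4 * (1 - D ^+ 2 / 2) -> 0 < b ->
  p < cone_prob n tau b ->
  exists phi : 'rV[R]_n.+1 -> R, [/\ blip phi, forall v, 0 <= phi v <= 1,
    forall v f, 0 < phi v -> F f -> 0 < dot v f & p <= gaussE phi].
Proof.
move=> F0 F1 FD t0 tD b0 pP.
have D0 : 0 <= D.
  by have [f Ff] := F0; rewrite (le_trans _ (FD f f Ff Ff))// enorm_ge0.
set P := cone_prob n tau b in pP; set a := 2^-1 + b.
have a0 : 0 < a by rewrite /a; lra.
have tc0 := tail_cst_gt0 b0.
set r := (Num.sqrt (1 + 2 * (a / tau ^+ 2)))^-1.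
have at0 : 0 < a / tau ^+ 2 by rewrite divr_gt0// exprn_gt0.
have r0 : 0 < r by rewrite invr_gt0 sqrtr_gt0; lra.
have PE : P = tail_cst b / 2 * r ^+ n by [].
have P0 : 0 < P by rewrite PE mulr_gt0 ?exprn_gt0// divr_gt0.
pose kappa := 1 - D ^+ 2 / 2; pose k := Num.sqrt kappa.
have kappa0 : 0 < kappa.
  by have := sqr_ge0 (tau * D); rewrite /kappa; lra.
have k0 : 0 < k by rewrite sqrtr_gt0.
have k2 : k ^+ 2 = kappa by rewrite sqr_sqrtr// ltW.
have tDk : tau * D < 2 * k.
  rewrite -ltr_sqr ?nnegrE ?mulr_ge0 ?(ltW t0) ?(ltW k0)//.
  by rewrite [ltRHS]exprMn k2 -natrX.
(* Strictly between tau D / 2, which makes [zeta] positive, and [k], which [approx_center]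
   requires. *)
pose c := (tau * D / 2 + k) / 2.
have tD0 : 0 <= tau * D by rewrite mulr_ge0// ltW.
have c0 : 0 < c by rewrite /c; lra.
have ck : c ^+ 2 < kappa.
  by rewrite -k2 ltr_sqr ?nnegrE ?(ltW c0) ?(ltW k0)// /c; lra.
have [u u1 uF] := approx_center F1 FD F0 c0 ck.
have [H [[lH iH] He EH]] := gaussE_isometry u1.
pose zeta := 2 * c - tau * D.
have z0 : 0 < zeta by rewrite /zeta /c; lra.
(* The cone is cut at height [x0], where the clamped function has had room to reach 1. This costs a
   factor e^(-a x0^2) >= 1 - a x0^2, and [x0] is chosen so that P (1 - a x0^2) = p. *)
pose x0 := Num.sqrt ((P - p) / (P * a)).
have x00 : 0 < x0 by rewrite sqrtr_gt0 divr_gt0 ?subr_gt0// mulr_gt0.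
have x02 : a * x0 ^+ 2 * P = P - p.
  rewrite sqr_sqrtr; last by rewrite divr_ge0 ?subr_ge0 ?(ltW pP)// mulr_ge0 ?ltW.
  by field; rewrite !gt_eqF.
(* At heights x >= x0 in the cone, [inf_dot] at a vector and at its mirror image add up to at least
   zeta x >= 2 eta. One of them is then at least [eta], and its clamped value is 1. *)
pose eta := zeta * x0 / 2.
have e0 : 0 < eta by rewrite divr_gt0// mulr_gt0.
pose phi v := clamp (inf_dot F v / eta).
have bphi : blip phi.
  split; first by exists 1 => v; rewrite ger0_norm ?clamp_ge0 ?clamp_le1.
  exists eta^-1 => v w; rewrite (le_trans (clamp_lipschitz _ _))//.
  rewrite -mulrBl normrM [X in _ * X]ger0_norm ?invr_ge0 ?(ltW e0)// mulrC.
  by rewrite ler_wpM2l ?invr_ge0 ?(ltW e0)//; exact: inf_dot_lipschitz.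
have phi0 v : 0 <= phi v by exact: clamp_ge0.
exists phi; split => //.
- by move=> v; rewrite clamp_ge0 clamp_le1.
- move=> v f /clamp_gt0; rewrite pmulr_lgt0 ?invr_gt0// => v0 Ff.
  by rewrite (lt_le_trans v0)//; exact: inf_dot_le.
have isoH : linear_isometry H by [].
have bH : blip (phi \o H) := blip_comp_isometry bphi (linear_isometryB isoH).
pose mir (v : 'rV[R]_n.+1) := snoc (- belast_row v) (v 0 ord_max).
have mirE y x : mir (snoc y x) = snoc (- y) x.
  rewrite /mir mxE unlift_none /=; congr (snoc (- _) _).
  by apply/rowP => i; rewrite !mxE liftK.
have bHm : blip ((phi \o H) \o mir).
  apply: blip_comp_isometry => // v w.
  rewrite -(snocK v) -(snocK w) !mirE !snocN !snocD !enorm_snoc.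
  by rewrite -opprD enormN.
have EHm : gaussE ((phi \o H) \o mir) = gaussE phi.
  rewrite -(EH _ bphi phi0).
  apply: (etrans _ (gaussEN (blip_gauss_mean bH) _)) => [|y].
    apply: (congr1 (@gaussE R n)); apply/funext => y.
    by apply: (congr1 (@gauss_mean R)); apply/funext => x; rewrite [LHS]/= mirE.
  rewrite -(gauss_mean_cst 0); apply: le_gauss_mean => //.
  - by exists 0 => x; rewrite normr0.
  - exact: blip_snoc_measurable.
  - exact: blip_snoc_bounded.
  - by move=> x; exact: phi0.
pose psi v := (phi \o H) v + ((phi \o H) \o mir) v.
have bpsi : blip psi by exact: blip_add.
have Epsi : gaussE psi = 2 * gaussE phi.
  apply: (etrans (gaussED bH bHm)); rewrite EHm (EH _ bphi phi0); ring.
have psi1 y x : enorm y / tau <= x -> x0 <= x -> 1 <= psi (snoc y x).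
  move=> yx x0x.
  pose V := H (snoc y x); pose W := H (snoc (- y) x).
  have VW : zeta * x - inf_dot F V <= inf_dot F W.
    apply: le_inf_dot => // g Fg; rewrite lerBlDr -lerBlDl.
    apply: le_inf_dot => // f Ff; rewrite lerBlDr.
    pose Y := H (snoc y 0).
    have HZ := linear_isometryZ isoH.
    have VE : V = x *: u + Y.
      by rewrite -He -lH snocZ snocD scaler0 add0r mulr1 addr0.
    have WE : W = x *: u - Y.
      rewrite -He -(scaleN1r Y) /Y -(HZ (-1)) -lH !snocZ snocD scaler0 add0r scaleN1r.
      by rewrite mulr1 mulr0 addr0.
    have Yfg : - (enorm y * D) <= dot Y (f - g).
      have := normr_dot_le Y (f - g); rewrite ler_norml iH enorm_snoc0 => /andP[h _].
      by rewrite (le_trans _ h)// lerN2 ler_wpM2l ?enorm_ge0// FD.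
    move: Yfg; rewrite VE WE !dotDl !dotZl !dotNl dotDr dotNr.
    have := uF f Ff; have := uF g Fg.
    have : enorm y * D <= tau * x * D by rewrite ler_wpM2r// mulrC -ler_pdivrMr.
    have xge0 : 0 <= x by rewrite (le_trans (ltW x00)).
    rewrite /zeta; nra.
  have zx : 2 * eta <= zeta * x by rewrite /eta mulrC divfK// ler_pM2l.
  rewrite /psi /= mirE -/V -/W.
  have [Ve|Ve] := lerP eta (inf_dot F V).
    by rewrite [phi V]clamp_eq1 ?lerDl// ler_pdivlMr// mul1r.
  rewrite [phi W]clamp_eq1 ?lerDr// ler_pdivlMr// mul1r.
  by move: VW zx Ve; lra.
have psi0 v : 0 <= psi v by rewrite addr_ge0//; exact: phi0.
have lbpsi : tail_cst b * expR (- (a * x0 ^+ 2)) * r ^+ n <= gaussE psi.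
  apply: gaussE_ge_expR; [exact: (blip_gauss_mean bpsi)|exact: ltW|] => y.
  (* The square of a maximum is at most the sum of the squares, which separates the factor of [x0]
     from a Gaussian in [y]. *)
  pose s := Num.max (enorm y / tau) x0.
  have ge0s : 0 <= s by rewrite le_max (ltW x00) orbT.
  apply: (@le_trans _ _ (tail_cst b * expR (- (a * s ^+ 2)))).
    rewrite -mulrA -expRD ler_pM2l// ler_expR -opprD lerN2.
    rewrite mulrAC -mulrA -mulrDr ler_pM2l// /s.
    rewrite -expr_div_n.
    have := sqr_ge0 x0; have := sqr_ge0 (enorm y / tau).
    by rewrite /Num.max; case: ltP => _; lra.
  apply: gauss_mean_tail => //.
  - exact: blip_snoc_measurable.
  - exact: blip_snoc_bounded.
  by move=> x; rewrite ge_max => /andP[]; exact: psi1.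
have : p <= P * expR (- (a * x0 ^+ 2)).
  have := expR_ge1Dx (- (a * x0 ^+ 2)); rewrite -(ler_pM2l P0).
  by apply: le_trans; lra.
move: lbpsi; rewrite Epsi PE; lra.
Qed.

End polar_cone.

(** * Greedy choice of directions *)

Section greedy.
Variables (R : realType) (V : eqType) (J : finType) (cov : J -> V -> Prop).

Definition covered (A : {set J}) (v : V) : {set J} := [set j in A | `[< cov j v >]].

(** The number of covered elements takes finitely many values, so its maximum over [v] satisfies the
    bound for every q < p, hence for p. *)
Lemma covered_sharp (p : R) (A : {set J}) : A != finset.set0 ->
  (forall q, q < p -> exists v, q * #|A|%:R <= #|covered A v|%:R) ->
  exists v, p * #|A|%:R <= #|covered A v|%:R.
Proof.
move=> A0 H; have cA : 0 < #|A|%:R :> R by rewrite ltr0n card_gt0.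
have [v0 _] : exists v, (p - 1) * #|A|%:R <= #|covered A v|%:R.
  by apply: H; rewrite ltrBlDr ltrDl.
pose P k := `[< exists v, #|covered A v| = k >].
have exP : exists k, P k by exists #|covered A v0|; apply/asboolP; exists v0.
have ubP k : P k -> (k <= #|A|)%N.
  move=> /asboolP[v <-]; apply: subset_leq_card.
  by apply/fintype.subsetP => j; rewrite inE => /andP[].
case: (ex_maxnP exP ubP) => k /asboolP[v vk] kmax.
exists v; rewrite leNgt; apply/negP => kp.
pose q0 : R := k%:R / #|A|%:R.
have q0p : q0 < p by rewrite ltr_pdivrMr// -vk.
have [w] : exists v, (q0 + p) / 2 * #|A|%:R <= #|covered A v|%:R.
  by apply: H; lra.
have wk : (#|covered A w| <= k)%N by apply: kmax; apply/asboolP; exists w.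
apply/negP; rewrite -ltNge; apply: (@le_lt_trans _ _ k%:R); first by rewrite ler_nat.
by rewrite -ltr_pdivrMr// -/q0; lra.
Qed.

(** The hypothesis offers no element of [V] for an empty remainder, hence the alternative of
    stopping early. *)
Lemma greedy (p : R) (N : nat) : p <= 1 ->
  (forall A : {set J}, A != finset.set0 -> exists v, p * #|A|%:R <= #|covered A v|%:R) ->
  exists (s : seq V) (B : {set J}),
    [/\ size s = N \/ B = finset.set0 /\ (size s <= N)%N,
        forall j, j \notin B -> exists2 v, v \in s & cov j v &
        #|B|%:R <= (1 - p) ^+ N * #|J|%:R].
Proof.
move=> p1 H; elim: N => [|N [s [B [sN sB cB]]]].
  exists [::], [set: J]%SET; split; [by left|by move=> j; rewrite inE|].
  by rewrite expr0 mul1r cardsT.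
have [B0|B0] := eqVneq B finset.set0.
  exists s, B; split => //.
    by right; split => //; case: sN => [->|[_ /leq_trans->]].
  by rewrite B0 cards0 mulr_ge0// exprn_ge0// subr_ge0.
have [v vB] := H B B0.
exists (v :: s), (B :\: covered B v)%SET; split.
- case: sN => [<-|[B0' _]]; first by left.
  by rewrite B0' eqxx in B0.
- move=> j; rewrite finset.in_setD negb_and negbK => /orP[|/sB[w ws jw]].
    by rewrite inE => /andP[_ /asboolP jv]; exists v; rewrite ?mem_head.
  by exists w => //; rewrite in_cons ws orbT.
- have cvB : covered B v \subset B.
    by apply/fintype.subsetP => j; rewrite inE => /andP[].
  rewrite cardsDS// natrB ?subset_leq_card//.
  apply: (@le_trans _ _ ((1 - p) * #|B|%:R)); first by move: vB; lra.
  by rewrite exprS -mulrA ler_wpM2l// subr_ge0.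
Qed.

Lemma greedy_cover (p : R) (N : nat) : 0 < p -> p <= 1 ->
  (forall q (A : {set J}), q < p -> A != finset.set0 ->
     exists v, q * #|A|%:R <= #|covered A v|%:R) ->
  exists2 s : seq V,
    (size s)%:R <= N%:R + expR (- (p * N%:R)) * #|J|%:R &
    forall j, exists2 v, v \in s & cov j v.
Proof.
move=> p0 p1 H.
have Hp (A : {set J}) (A0 : A != finset.set0) : exists v, p * #|A|%:R <= #|covered A v|%:R.
  by apply: covered_sharp => // q qp; exact: H.
(* On a singleton, a positive proportion means that its element is covered. *)
have cov1 j : exists v, cov j v.
  have [|v] := Hp [set j]%SET.
    by apply/set0Pn; exists j; rewrite inE.
  rewrite cards1 mulr1 => pv; have : (0 < #|covered [set j]%SET v|)%N.
    by rewrite -(ltr0n R) (lt_le_trans p0).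
  by rewrite card_gt0 => /set0Pn[i]; rewrite !inE => /andP[/eqP-> /asboolP]; exists v.
have [f fP] := choice cov1.
have [s [B [sN sB cB]]] := greedy N p1 Hp.
exists (s ++ [seq f j | j <- enum B]) => [|j].
  rewrite size_cat size_map -cardE natrD lerD//.
    by rewrite ler_nat; case: sN => [->|[]].
  apply: (le_trans cB); rewrite ler_wpM2r//.
  rewrite -mulNr mulrC expRM_natl.
  rewrite lerXn2r ?nnegrE ?expR_ge0 ?subr_ge0//.
  exact: expR_ge1Dx.
have [jB|/sB[v vs jv]] := boolP (j \in B); last first.
  by exists v => //; rewrite mem_cat vs.
exists (f j) => //; rewrite mem_cat; apply/orP; right.
by apply: map_f; rewrite mem_enum.
Qed.

End greedy.

(** * Illumination of ball bodies *)

Section spindle.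
Variables (R : realType) (d : nat).
Implicit Types (X : set 'rV[R]_d) (x y b v : 'rV[R]_d).

Lemma enorm_le_norm x : enorm x <= Num.sqrt d%:R * `|x|.
Proof.
rewrite -[leRHS]ger0_norm ?mulr_ge0// -sqrtr_sqr ler_sqrt ?sqr_ge0//.
rewrite exprMn sqr_sqrtr// mulr_natl.
have -> : `|x| ^+ 2 *+ d = \sum_(i < d) `|x| ^+ 2 by rewrite sumr_const card_ord.
apply: ler_sum => i _; rewrite -real_normK ?num_real//.
rewrite ler_sqr ?nnegrE//.
rewrite [leRHS]/Num.norm /= mx_normrE.
by apply/bigmax_geP; right => /=; exists (0, i).
Qed.

Lemma enormB_continuous b : continuous (fun x => enorm (x - b)).
Proof.
apply: (@lipschitz_continuous R _ _ (Num.sqrt d%:R)) => x y.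
apply: (le_trans _ (enorm_le_norm _)).
have H z w : enorm (z - b) - enorm (w - b) <= enorm (z - w).
  rewrite lerBlDr (le_trans _ (enorm_triangle _ _))//.
  by rewrite addrA subrK.
have := H x y; have := H y x; rewrite (enormB y x) => h1 h2.
by rewrite ler_norml; apply/andP; split; lra.
Qed.

Lemma dotB_continuous v b : continuous (fun x => dot v (x - b)).
Proof.
apply: (@lipschitz_continuous R _ _ (enorm v * Num.sqrt d%:R)) => x y.
rewrite -dotNr -dotDr opprB addrA subrK -mulrA.
rewrite (le_trans (normr_dot_le _ _))// ler_wpM2l ?enorm_ge0//.
exact: enorm_le_norm.
Qed.

Lemma interior_ball_body X y (e : R) : 0 < e ->
  (forall x, X x -> enorm (y - x) <= 1 - e) -> (ball_body X)° y.
Proof.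
move=> e0 yX; rewrite /interior /=.
have : \forall z \near y, enorm (z - y) < e.
  have := @enormB_continuous y y; rewrite /continuous_at subrr enorm0.
  by move=> /cvgrPdist_lt /(_ e e0); apply: filterS => z;
    rewrite sub0r normrN ger0_norm ?enorm_ge0.
apply: filterS => z zy x Xx; rewrite /unit_ball /=.
have -> : z - x = (z - y) + (y - x) by rewrite addrA subrK.
by rewrite (le_trans (enorm_triangle _ _))//; have := yX x Xx; lra.
Qed.

Lemma closed_ball_body X : closed (ball_body X).
Proof.
apply: closed_bigI => x _.
apply: (@closed_comp _ _ (fun y => enorm (y - x)) [set r : R | r <= 1]).
  by move=> y _; exact: enormB_continuous.
exact: closed_le.
Qed.

Lemma boundary_ball_body X b : boundary (ball_body X) b ->
  forall x, X x -> enorm (x - b) <= 1.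
Proof.
move=> [+ _] x Xx; rewrite enormB.
by move=> /(@closed_ball_body X) /(_ x Xx).
Qed.

Lemma illuminates_ball_body X b v : X !=set0 -> compact X ->
  boundary (ball_body X) b ->
  (forall x, X x -> enorm (x - b) = 1 -> 0 < dot v (x - b)) ->
  illuminates_point (ball_body X) v b.
Proof.
move=> X0 cX bb vX.
(* Positive on [X], so by compactness at least some rho > 0: each x in [X] is either at distance at
   most 1 - rho from [b], or satisfies <v, x - b> >= rho. *)
pose g x := Num.max (1 - enorm (x - b)) (dot v (x - b)).
have cg : continuous g.
  move=> x; apply: (@continuous_max _ _ (fun x => 1 - enorm (x - b))
    (fun x => dot v (x - b))); last exact: dotB_continuous.
  apply: (@continuousB R R^o _ (cst 1) (fun x => enorm (x - b))).
    exact: cst_continuous.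
  exact: enormB_continuous.
have [c Xc cmin] := compact_EVT_min X0 cX (continuous_subspaceT cg).
rewrite inE in Xc.
have gc0 : 0 < g c.
  have := boundary_ball_body bb Xc; rewrite le_eqVlt => /orP[/eqP e1|lt1].
    by rewrite lt_max vX// orbT.
  by rewrite lt_max subr_gt0 lt1.
have g1 x : X x -> g c <= 1 - enorm (x - b) \/ g c <= dot v (x - b).
  by move=> Xx; have := cmin x; rewrite inE => /(_ Xx); rewrite le_max => /orP.
move: (g c) gc0 g1 => rho rho0 g1.
set V := enorm v; have V0 : 0 <= V := enorm_ge0 v.
(* Small enough that t |v| <= rho / 2, for the points far from the unit sphere, and t |v|^2 <= rho,
   so that the gain 2 t rho in the squared distance dominates t^2 |v|^2. Adding 1 covers both bounds
   and the case v = 0. *)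
pose t := rho / (2 * (V ^+ 2 + 1)).
have V20 : 0 < V ^+ 2 + 1 by rewrite ltr_wpDl ?sqr_ge0.
have t0 : 0 < t by rewrite divr_gt0// mulr_gt0.
have tV2 : t * V ^+ 2 + t = rho / 2.
  by rewrite /t; field; lra.
have tV : t * V <= rho / 2.
  have VV : V <= V ^+ 2 + 1 by have := sqr_ge0 (V - 1); lra.
  have : t * V <= t * (V ^+ 2 + 1) by rewrite ler_pM2l.
  lra.
exists (b + t *: v); split; first by exists t => //=; exact: ltW.
pose e := Num.min (rho / 2) (t * rho / 2).
have e0 : 0 < e by rewrite lt_min !divr_gt0// mulr_gt0.
apply: (@interior_ball_body _ _ e) => // x Xx.
have -> : b + t *: v - x = t *: v - (x - b) by rewrite opprB addrA [t *: v + b]addrC.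
have e1 : e <= rho / 2 by rewrite ge_min lexx.
have e2 : e <= t * rho / 2 by rewrite ge_min lexx orbT.
have xb1 := boundary_ball_body bb Xx.
have xb0 := enorm_ge0 (x - b).
case: (g1 x Xx) => h.
  rewrite (le_trans (enorm_triangle _ _))// enormN enormZ gtr0_norm// -/V.
  by lra.
have hs : enorm (t *: v - (x - b)) ^+ 2 <= 1 - t * rho.
  rewrite enorm_sqr dotDl !dotDr !dotNl !dotNr !dotZl !dotZr (dotC (x - b) v).
  rewrite -!enorm_sqr -/V.
  have : t * rho <= t * dot v (x - b) by rewrite ler_pM2l.
  have : enorm (x - b) ^+ 2 <= 1 by rewrite expr_le1.
  have : t * (t * V ^+ 2) <= t * rho by rewrite ler_pM2l//; lra.
  lra.
have t1 : 0 <= 1 - t * rho by rewrite (le_trans _ hs)// sqr_ge0.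
have : 0 <= enorm (t *: v - (x - b)) := enorm_ge0 _.
nra.
Qed.

Lemma diam_le1 X x y : (diam X <= 1%:E)%E -> X x -> X y -> enorm (x - y) <= 1.
Proof.
move=> dX Xx Xy; rewrite -lee_fin (le_trans _ dX)//.
by apply: ereal_sup_ubound; exists (x, y).
Qed.

(** If [X] has two points at distance r > 0, the parallelogram law puts their midpoint at squared
    distance at most 1 - r^2 / 4 from all of [X], hence at distance at most 1 - r^2 / 8. If [X] is a
    singleton, its point is interior. *)
Lemma ball_body_interior_nonempty X : X !=set0 -> (diam X <= 1%:E)%E ->
  (ball_body X)° !=set0.
Proof.
move=> [x0 Xx0] dX; have [[x1 Xx1 /eqP x01]|nX] := pselect (exists2 x1, X x1 & x1 <> x0).
  pose r := enorm (x1 - x0).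
  have r0 : 0 < r.
    rewrite lt_def enorm_ge0 andbT; apply: contra x01 => /eqP/enorm_eq0 /eqP.
    by rewrite subr_eq0.
  have r1 : r <= 1 by exact: (diam_le1 dX).
  exists (2^-1 *: (x0 + x1)); apply: (@interior_ball_body _ _ (r ^+ 2 / 8)).
    by rewrite divr_gt0// exprn_gt0.
  move=> x Xx.
  set p := x0 - x; set q := x1 - x.
  have -> : 2^-1 *: (x0 + x1) - x = 2^-1 *: (p + q).
    rewrite /p /q addrACA -opprD scalerBr; congr (_ - _).
    by rewrite -mulr2n -[x *+ 2]scaler_nat scalerA mulVf// scale1r.
  have rE : r ^+ 2 = dot (q - p) (q - p).
    by rewrite -enorm_sqr /r /p /q opprB addrA subrK.
  have p1 : enorm p ^+ 2 <= 1 by rewrite expr_le1 ?enorm_ge0// (diam_le1 dX).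
  have q1 : enorm q ^+ 2 <= 1 by rewrite expr_le1 ?enorm_ge0// (diam_le1 dX).
  clearbody p q; have := enorm_ge0 (2^-1 *: (p + q)).
  have : enorm (2^-1 *: (p + q)) ^+ 2 <= 1 - r ^+ 2 / 4.
    move: p1 q1; rewrite rE !enorm_sqr dotZl dotZr !dotDl !dotDr !dotNl !dotNr.
    by rewrite (dotC q p); lra.
  have : r ^+ 2 <= 1 by rewrite expr_le1// ltW.
  nra.
exists x0; apply: (@interior_ball_body _ _ 1) => // x Xx.
have -> : x = x0 by apply: contrapT => xx0; apply: nX; exists x.
by rewrite !subrr enorm0.
Qed.

Lemma spindle_ball_body X : X !=set0 -> compact X -> (diam X <= 1%:E)%E ->
  spindle_convex_body (ball_body X).
Proof. by move=> X0 cX dX; exists X; split => //; exact: ball_body_interior_nonempty. Qed.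

End spindle.

(** * Cells of the cube and the covering argument *)

Section covering.
Variable R : realType.

Let root_ge1 (tau b : R) : 0 < b -> 1 <= Num.sqrt (1 + 2 * ((2^-1 + b) / tau ^+ 2)).
Proof.
move=> b0; rewrite -[leLHS]sqrtr1 ler_wsqrtr// lerDl mulr_ge0//.
by rewrite divr_ge0 ?sqr_ge0// addr_ge0// ltW.
Qed.

Lemma cone_prob_gt0 n (tau b : R) : 0 < b -> 0 < cone_prob n tau b.
Proof.
move=> b0; apply: mulr_gt0; first by rewrite divr_gt0// tail_cst_gt0.
by rewrite exprn_gt0// invr_gt0 (lt_le_trans _ (root_ge1 tau b0)).
Qed.

Lemma cone_prob_le1 n (tau b : R) : 0 < b -> cone_prob n tau b <= 1.
Proof.
(* The tail bound at s = 0 for the constant function 1. *)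
move=> b0; have tc1 : tail_cst b <= 1.
  have := @gauss_mean_tail R b 0 (fun=> 1) b0 (lexx _) (measurable_cst _).
  rewrite gauss_mean_cst expr0n mulr0 oppr0 expR0 mulr1; apply=> //.
  by exists 1 => x; rewrite normr1.
have r1 := root_ge1 tau b0; have tc0 := tail_cst_gt0 b0.
rewrite /cone_prob; set r := _ ^-1 ^+ n.
have r01 : 0 <= r <= 1.
  rewrite exprn_ge0 ?invr_ge0 ?sqrtr_ge0//= exprn_ile1 ?invr_ge0 ?sqrtr_ge0//.
  by rewrite invf_le1// (lt_le_trans _ r1).
have /andP[r0 r1'] := r01; have := tc0; have := tc1; nra.
Qed.

Section grid.
Variables (d m : nat) (x0 : 'rV[R]_d).

(** The cube of half side 1 around [x0], cut into [m] parts in each direction. Index [m] is taken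
    only on the far faces; it is the reason for (m + 1)^d cells instead of m^d. *)
Definition cell (b : 'rV[R]_d) : {ffun 'I_d -> 'I_m.+1} :=
  [ffun i => inord (Num.truncn ((b 0 i - x0 0 i + 1) * m%:R / 2))].

Lemma coord_le_enorm (x : 'rV[R]_d) i : `|x 0 i| <= enorm x.
Proof.
rewrite -sqrtr_sqr ler_wsqrtr// (bigD1 i)//= lerDl.
by apply: sumr_ge0 => j _; exact: sqr_ge0.
Qed.

Lemma cell_close b b' : (0 < m)%N -> enorm (x0 - b) <= 1 -> enorm (x0 - b') <= 1 ->
  cell b = cell b' -> enorm (b - b') <= 2 * Num.sqrt d%:R / m%:R.
Proof.
move=> m0 xb xb' bb'; have mR : 0 < m%:R :> R by rewrite ltr0n.
have H c i : enorm (x0 - c) <= 1 ->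
    (cell c i : nat)%:R <= (c 0 i - x0 0 i + 1) * m%:R / 2 < (cell c i : nat)%:R + 1.
  move=> xc; set t := _ / 2; set k := (cell c i : nat)%:R; have := le_trans (coord_le_enorm (x0 - c) i) xc.
  rewrite !mxE ler_norml => /andP[l1 l2].
  have t0 : 0 <= t by rewrite /t !mulr_ge0//; lra.
  have tm : t <= m%:R.
    rewrite /t ler_pdivrMr// mulrC ler_pM2l//; lra.
  have := truncn_itv t0.
  rewrite /k ffunE inordK ?ltnS.
    by rewrite -natr1.
  rewrite -(ler_nat R) (le_trans _ tm)//.
  by have /andP[] := truncn_itv t0.
have Hi i : `|b 0 i - b' 0 i| <= 2 / m%:R.
  have /andP[h1 h2] := H b i xb; have /andP[h3 h4] := H b' i xb'.
  rewrite -bb' in h3 h4.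
  rewrite ler_pdivlMr// -[X in _ * X]ger0_norm// -normrM ler_norml.
  by apply/andP; split; lra.
have m2 : 0 <= 2 / m%:R :> R by rewrite divr_ge0.
rewrite mulrAC -[leRHS]ger0_norm ?mulr_ge0// -sqrtr_sqr ler_wsqrtr//.
rewrite exprMn sqr_sqrtr// mulr_natr.
have -> : (2 / m%:R) ^+ 2 *+ d = \sum_(i < d) (2 / m%:R : R) ^+ 2.
  by rewrite sumr_const card_ord.
apply: ler_sum => i _; rewrite !mxE -real_normK ?num_real//.
by rewrite ler_sqr ?nnegrE.
Qed.

End grid.

Lemma illuminable_ball_body n (X : set 'rV[R]_n.+1) (m N : nat) (tau b : R) :
  let D := 1 + 2 * Num.sqrt n.+1%:R / m%:R in
  X !=set0 -> compact X -> (diam X <= 1%:E)%E -> (0 < m)%N ->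
  0 < tau -> (tau * D) ^+ 2 < 4 * (1 - D ^+ 2 / 2) -> 0 < b ->
  exists2 k, illuminable_by (ball_body X) k &
    k%:R <= N%:R + expR (- (cone_prob n tau b * N%:R)) * (m.+1%:R) ^+ n.+1.
Proof.
move=> D X0 cX dX m0 t0 tD b0; have [x0 Xx0] := X0.
pose bd := boundary (ball_body X).
pose F j := [set f | exists c x, [/\ bd c, cell m x0 c = j, X x, enorm (x - c) = 1 & f = x - c]].
pose cov j v := forall f, F j f -> 0 < dot v f.
have F1 j f : F j f -> enorm f = 1 by move=> [c [x [_ _ _ ? ->]]].
have FD j f g : F j f -> F j g -> enorm (f - g) <= D.
  move=> [c [x [bc cj Xx _ ->]]] [c' [x' [bc' c'j Xx' _ ->]]].
  have -> : x - c - (x' - c') = (x - x') + (c' - c).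
    by rewrite opprB [c' - x']addrC addrACA [- c + c']addrC.
  rewrite (le_trans (enorm_triangle _ _))// lerD ?(diam_le1 dX)//.
  apply: (cell_close (x0 := x0)) => //; last by rewrite cj c'j.
    exact: boundary_ball_body bc' _ Xx0.
  exact: boundary_ball_body bc _ Xx0.
set p := cone_prob n tau b.
have p0 : 0 < p by exact: cone_prob_gt0.
have p1 : p <= 1 by exact: cone_prob_le1.
have phiP q j : q < p -> exists phi : 'rV[R]_n.+1 -> R,
    [/\ blip phi, forall v, 0 <= phi v <= 1,
        forall v, 0 < phi v -> cov j v & q <= gaussE phi].
  (* A cell with no unit vector x - c to serve is covered by every direction. *)
  move=> qp; have [F0|/set0P F0] := eqVneq (F j) set0.
    exists (fun=> 1); split => [||v _ f|]; first exact: blip_cst.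
    - by move=> v; rewrite ler01 lexx.
    - by rewrite F0.
    - by rewrite gaussE_cst; lra.
  have [phi [bphi phi01 phiF Ephi]] :=
    gaussE_polar F0 (@F1 j) (@FD j) t0 tD b0 qp.
  by exists phi; split => // v v0 f Ff; exact: phiF v0 Ff.
have [q A qp A0|s sN scov] := @greedy_cover R 'rV[R]_n.+1 _ cov p N p0 p1.
  have [phi phiq] := choice (fun j => phiP ((q + p) / 2) j ltac:(lra)).
  (* Averaging: if every v covered less than the proportion q of [A], the sum of the phi_j would be
     at most q |A| pointwise, hence in mean, whereas each phi_j has mean at least (q + p) / 2 >
     q. *)
  apply: contrapT => nv.
  have small v : \sum_(j in A) phi j v <= q * #|A|%:R.
    rewrite leNgt; apply/negP => qv; apply: nv; exists v.
    apply/ltW/(lt_le_trans qv).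
    rewrite -sum1_card natr_sum (bigID (fun j => `[< cov j v >])) /=.
    rewrite [X in _ + X]big1 ?addr0 => [|j /andP[_ jv]].
      rewrite (eq_bigl (mem (covered cov A v))) => [|j]; last by rewrite !inE.
      by apply: ler_sum => j _; have [_ /(_ v) /andP[]] := phiq j.
    have [_ /(_ v) /andP[pj0 _] phij _] := phiq j.
    apply/eqP; apply: contraNT jv => pj; apply/asboolP; apply: phij.
    by rewrite lt_def pj.
  have bs (j : {ffun 'I_n.+1 -> 'I_m.+1}) : blip (phi j) by have [] := phiq j.
  have : gaussE (fun v => \sum_(j in A) phi j v) <= q * #|A|%:R.
    rewrite -[leRHS](gaussE_cst n.+1); apply: le_gaussE => //.
      exact: blip_sum.
    exact: blip_cst.
  rewrite gaussE_sum//; apply/negP; rewrite -ltNge.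
  apply: (@lt_le_trans _ _ ((q + p) / 2 * #|A|%:R)).
    by rewrite ltr_pM2r ?ltr0n ?card_gt0//; lra.
  rewrite -sum1_card natr_sum mulr_sumr; apply: ler_sum => j _.
  by rewrite mulr1; have [] := phiq j.
exists (size s); last first.
  apply: (le_trans sN); rewrite lerD2l card_ffun !card_ord.
  by rewrite natrX.
pose e : 'rV[R]_n.+1 := snoc 0 1.
(* The zero vector may occur in [s], since it covers the cells for which [F j] is empty; its
   direction is then arbitrary. *)
pose dir v : 'rV[R]_n.+1 := if v == 0 then e else (enorm v)^-1 *: v.
have dir1 v : enorm (dir v) = 1.
  rewrite /dir; case: eqVneq => [_|v0]; first by rewrite enorm_0snoc normr1.
  have v1 : enorm v != 0 by apply: contra_neq v0; exact: enorm_eq0.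
  by rewrite enormZ ger0_norm ?invr_ge0 ?enorm_ge0// mulVf.
exists (fun i => dir (nth 0 s i)); split => [i|c bc]; first exact: dir1.
have [v vs cv] := scov (cell m x0 c).
have vc x : X x -> enorm (x - c) = 1 -> 0 < dot v (x - c).
  by move=> Xx xc; apply: cv; exists c, x.
have iv : (index v s < size s)%N by rewrite index_mem.
exists (Ordinal iv); rewrite /= nth_index//.
(* The halfline of direction 0 is the point [c] alone, and a boundary point is not interior. *)
have v0 : v != 0.
  apply/eqP => v0; have [y [[t _ <-]]] := illuminates_ball_body X0 cX bc vc.
  by rewrite v0 scaler0 addr0; case: bc.
apply: illuminates_ball_body => // x Xx xc.
rewrite /dir (negbTE v0) dotZl mulr_gt0 ?vc// invr_gt0 lt_def enorm_ge0 andbT.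
by apply: contra_neq v0; exact: enorm_eq0.
Qed.

Lemma exists_illumination_number d (K : set 'rV[R]_d) k : illuminable_by K k ->
  exists2 l, is_illumination_number K l & (l <= k)%N.
Proof.
move=> Kk; pose P l := `[< illuminable_by K l >].
have exP : exists l, P l by exists k; apply/asboolP.
case: (ex_minnP exP) => l /asboolP Kl lmin; exists l.
  by split => // l' Kl'; apply: lmin; apply/asboolP.
by apply: lmin; apply/asboolP.
Qed.

End covering.

(** * Numerical estimates *)

Section numeric.
Variable R : realType.
Implicit Types x z L : R.

Lemma expR_ge_taylor x n : 0 <= x -> \sum_(0 <= i < n) x ^+ i / i`!%:R <= expR x.
Proof.
move=> x0; have nd : nondecreasing_seq (series (exp_coeff x)).
  apply/nondecreasing_seqP => k; rewrite /series /= big_nat_recr//= lerDl.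
  by rewrite /exp_coeff /= divr_ge0// exprn_ge0.
exact: nondecreasing_cvgn_le nd (is_cvg_series_exp_coeff x) n.
Qed.

(** An upper bound drawn from e^(-z/8) >= 1 - z/8; the eighth power is precise enough for the two
    constants below. *)
Lemma expR_le_inv8 z : z < 8 -> expR z <= (1 - z / 8)^-1 ^+ 8.
Proof.
move=> z8; have h0 : 0 < 1 - z / 8 by lra.
rewrite -[z in leLHS](opprK z) expRN exprVn lef_pV2 ?posrE ?expR_gt0 ?exprn_gt0//.
have -> : - z = 8%:R * (- (z / 8)) by field.
rewrite expRM_natl lerXn2r ?nnegrE ?expR_ge0 ?(ltW h0)//.
exact: expR_ge1Dx.
Qed.

Lemma expR1_le3 : expR 1 <= 3 :> R.
Proof.
apply: le_trans (expR_le_inv8 _) _; first lra.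
have -> : (1 - 1 / 8)^-1 = 8 / 7 :> R by field.
lra.
Qed.

Lemma expR_fifth_le : expR (1 / 5) <= 49 / 40 :> R.
Proof.
apply: le_trans (expR_le_inv8 _) _; first lra.
have -> : (1 - 1 / 5 / 8)^-1 = 40 / 39 :> R by field.
lra.
Qed.

(** The tangent at 3, the least dimension, with ln 3 <= 11/10. *)
Lemma ln_le_tangent x : 0 < x -> ln x <= x / 3 + 1 / 10.
Proof.
move=> x0; have x3 : 0 < x / 3 by rewrite divr_gt0.
have -> : x = 3 * (x / 3) by field.
rewrite lnM ?posrE//.
have h1 : ln (x / 3) <= x / 3 - 1.
  by have := @le_ln1Dx R (x / 3 - 1); rewrite subrKC; apply; lra.
have h2 : ln 3 <= 11 / 10 :> R.
  rewrite -[leRHS]expRK ler_ln ?posrE ?expR_gt0//.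
  apply: le_trans (expR_ge_taylor 7 _); last lra.
  rewrite unlock /= /factorial /=; lra.
have -> : 3 * (x / 3) / 3 = x / 3 by field.
lra.
Qed.

Lemma expR_13_5_ge : 40 / 3 <= expR (13 / 5) :> R.
Proof.
have -> : 13 / 5 = 2%:R * (13 / 10) :> R by field.
have h : 183 / 50 <= expR (13 / 10) :> R.
  apply: le_trans (expR_ge_taylor 6 _); last lra.
  rewrite unlock /= /factorial /=; lra.
rewrite expRM_natl (@le_trans _ _ ((183 / 50) ^+ 2))//; first lra.
by rewrite lerXn2r ?nnegrE ?expR_ge0//; lra.
Qed.

(** With x = d the left side is the base of the power in [cone_prob]. For delta = 0 it equals 3/2 (1
    + 1 / (x + 3)), so [h] pays for the cell diameter; its denominator x - 1 = n makes n h
    simple. *)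
Lemma slope_bound x (delta := 3 / 10 / (2 * x - 3)) (h := (1 / 5 + 39 / 50 / x) / (x - 1)) :
  3 <= x ->
  1 + (1 + 3 / (x + 3)) / (4 / (1 + delta) ^+ 2 - 2) <=
  3 / 2 * (1 + 1 / (x + 3)) * (1 + h).
Proof.
move=> x3; pose u := 2 * x - 3.
have u3 : 3 <= u by rewrite /u; lra.
pose v := u ^+ 2 - 3 / 5 * u - 9 / 100.
have v0 : 0 < v by rewrite /v; nra.
(* The relative excess of 1 / tau^2 over its value 1/2 at delta = 0. *)
pose theta := (6 / 5 * u + 9 / 50) / v.
have e1 : (4 / (1 + delta) ^+ 2 - 2)^-1 = 2^-1 * (1 + theta).
  have -> : 4 / (1 + delta) ^+ 2 - 2 = 2 * v / (u + 3 / 10) ^+ 2.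
    by rewrite /delta /v /u; field; rewrite -?/u; apply/andP; split; rewrite gt_eqF//; lra.
  have -> : (u + 3 / 10) ^+ 2 = v + (6 / 5 * u + 9 / 50) by rewrite /v; field.
  by rewrite /theta; field; rewrite !gt_eqF//; lra.
have e2 : theta * (1 + 3 / (x + 3)) <= 3 * (1 + 1 / (x + 3)) * h.
  rewrite -subr_ge0.
  have -> : 3 * (1 + 1 / (x + 3)) * h - theta * (1 + 3 / (x + 3)) =
      (3 * (x + 4) * v * (1 / 5 * x + 39 / 50) - (6 / 5 * u + 9 / 50) * (x + 6) * (x - 1) * x)
      / ((x + 3) * x * (x - 1) * v).
    rewrite /theta /h; field; rewrite !gt_eqF//; lra.
  have x1 : 0 < x - 1 by lra.
  have x30 : 0 < x + 3 by lra.
  have x0 : 0 < x by lra.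
  rewrite divr_ge0 ?mulr_ge0 ?(ltW v0) ?(ltW x1) ?(ltW x30) ?(ltW x0)//.
  (* In powers of s = x - 3 every coefficient of the numerator is nonnegative. *)
  rewrite /v /u; pose s := x - 3; have -> : x = 3 + s by rewrite /s; ring.
  have s0 : 0 <= s by rewrite /s; lra.
  have s2 := exprn_ge0 2 s0; have s3 := exprn_ge0 3 s0; lra.
rewrite e1; move: e2; move: (theta) (h) => th hh; clear; lra.
Qed.

(** Controls what remains of 1 / p besides its constants and (3/2)^(n/2). The constant 57/50 lies
    above the limit e^(1/10) of the quotient by sqrt x, and the term in 1/x serves small dimensions.
    Squaring and rational bounds on the exponentials leave a polynomial inequality. *)
Lemma growth_bound x : 3 <= x ->
  (1 + 3 / (x + 3)) * Num.sqrt (x + 3) * expR (- (2 / (x + 3)) + 1 / 10 + 39 / 100 / x) <=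
  (57 / 50 + 127 / 50 / x) * Num.sqrt x.
Proof.
move=> x3; have x0 : 0 < x by lra.
have t0 : 0 < x + 3 by lra.
set E := expR _.
have g0 : 0 <= 57 / 50 + 127 / 50 / x by rewrite addr_ge0// divr_ge0// ltW.
have w0 : 0 <= 1 + 3 / (x + 3) by rewrite addr_ge0// divr_ge0// ltW.
rewrite -ler_sqr ?nnegrE ?mulr_ge0 ?sqrtr_ge0 ?expR_ge0//.
rewrite !exprMn !sqr_sqrtr ?(ltW x0) ?(ltW t0)//.
pose c := x - 39 / 200.
have c0 : 0 < c by rewrite /c; lra.
pose r := x ^+ 2 + 10 * x + 29.
have r0 : 0 < r by rewrite /r; nra.
have E2 : E ^+ 2 <= (x + 3) ^+ 2 / r * (49 / 40) * (x / c) ^+ 4.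
  have -> : E ^+ 2 = expR (- (4 / (x + 3))) * expR (1 / 5) * expR (39 / 50 / x).
    rewrite -expRM_natl -!expRD; congr expR; field.
    by rewrite !gt_eqF.
  have h1 : expR (- (4 / (x + 3))) <= (x + 3) ^+ 2 / r.
    rewrite expRN -[leRHS]invrK invf_div lef_pV2 ?posrE ?expR_gt0//; last first.
      by rewrite divr_gt0// exprn_gt0.
    apply: le_trans (expR_ge_taylor 3 _); last by rewrite divr_ge0// ltW.
    rewrite unlock /= /factorial /= /r.
    rewrite le_eqVlt; apply/orP; left; apply/eqP; field.
    by rewrite gt_eqF.
  have h2 : expR (39 / 50 / x) <= (x / c) ^+ 4.
    have -> : 39 / 50 / x = 4%:R * (39 / 200 / x) by field; rewrite gt_eqF.
    rewrite expRM_natl lerXn2r ?nnegrE ?expR_ge0 ?divr_ge0 ?(ltW x0) ?(ltW c0)//.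
    have -> : x / c = (c / x)^-1 by rewrite invf_div.
    rewrite -[leLHS]invrK -expRN lef_pV2 ?posrE ?expR_gt0 ?divr_gt0//.
    apply: le_trans (expR_ge1Dx _).
    rewrite /c le_eqVlt; apply/orP; left; apply/eqP; field.
    by rewrite gt_eqF.
  apply: ler_pM => //; rewrite ?mulr_ge0 ?expR_ge0//.
  by apply: ler_pM => //; rewrite ?expR_ge0// expR_fifth_le.
apply: le_trans (ler_wpM2l _ E2) _.
  by rewrite mulr_ge0 ?sqr_ge0// ltW.
rewrite -subr_ge0.
have -> : (57 / 50 + 127 / 50 / x) ^+ 2 * x -
    (1 + 3 / (x + 3)) ^+ 2 * (x + 3) * ((x + 3) ^+ 2 / r * (49 / 40) * (x / c) ^+ 4) =
    ((57 / 50 * x + 127 / 50) ^+ 2 * r * c ^+ 4 -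
     49 / 40 * (x + 6) ^+ 2 * (x + 3) * x ^+ 5) / (x * r * c ^+ 4).
  by field; rewrite !gt_eqF.
rewrite divr_ge0 ?mulr_ge0 ?exprn_ge0 ?(ltW x0) ?(ltW r0) ?(ltW c0)//.
rewrite /r /c; pose s := x - 3; have -> : x = 3 + s by rewrite /s; ring.
have s0 : 0 <= s by rewrite /s; lra.
have s2 := exprn_ge0 2 s0; have s3 := exprn_ge0 3 s0; have s4 := exprn_ge0 4 s0.
have s5 := exprn_ge0 5 s0; have s6 := exprn_ge0 6 s0; have s7 := exprn_ge0 7 s0.
have s8 := exprn_ge0 8 s0; lra.
Qed.

(* Affine in [L], hence enough to check at both ends of its range. *)
Lemma margin_bound x L : 3 <= x -> 0 <= L -> L <= x / 3 + 1 / 10 ->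
  (x * (3 / 2 * L + 13 / 5) - 12 / 5) * (57 / 50 + 127 / 50 / x) + 67 / 100 <=
  71 / 41 * x * (3 + L).
Proof.
move=> x3 L0 L1; have x0 : 0 < x by lra.
pose s := x - 3; have xE : x = 3 + s by rewrite /s; ring.
have s0 : 0 <= s by rewrite /s; lra.
have s2 := exprn_ge0 2 s0; have s3 := exprn_ge0 3 s0.
clearbody s; rewrite -subr_ge0.
pose G (l : R) := 71 / 41 * x * (3 + l) -
  ((x * (3 / 2 * l + 13 / 5) - 12 / 5) * (57 / 50 + 127 / 50 / x) + 67 / 100).
(* The upper end of the range of [L], which is the bound of [ln_le_tangent]. *)
pose B := x / 3 + 1 / 10.
have B0 : 0 < B by rewrite /B; lra.
have G0 : 0 <= G 0.
  have -> : G 0 = (x ^+ 2 * (71 / 41 * 3 - 13 / 5 * (57 / 50))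
     - x * (13 / 5 * (127 / 50) - 12 / 5 * (57 / 50) + 67 / 100) + 12 / 5 * (127 / 50)) / x.
    by rewrite /G; field; rewrite gt_eqF.
  apply: divr_ge0 (ltW x0); rewrite xE; move: s0 s2 s3; clear; lra.
have GB : 0 <= G B.
  have -> : G B = (x * (71 / 41 * x * (3 + B)) - ((x * (3 / 2 * B + 13 / 5) - 12 / 5) *
     (57 / 50 * x + 127 / 50) + 67 / 100 * x)) / x.
    by rewrite /G; field; rewrite gt_eqF.
  apply: divr_ge0 (ltW x0); rewrite /B xE; move: s0 s2 s3; clear; lra.
have -> : 71 / 41 * x * (3 + L) -
  ((x * (3 / 2 * L + 13 / 5) - 12 / 5) * (57 / 50 + 127 / 50 / x) + 67 / 100) =
  ((B - L) * G 0 + L * G B) / B.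
  rewrite /G; field; rewrite !gt_eqF//.
by rewrite divr_ge0 ?(ltW B0)// addr_ge0// mulr_ge0// subr_ge0.
Qed.

End numeric.

(** * Choice of the parameters and the resulting bound *)

Section cone_prob_bound.
Variables (R : realType) (n : nat).
Let x : R := n.+1%:R.
Let t : R := x + 3.
(* Upper bound on the diameter of the cells. *)
Let delta : R := 3 / 10 / (2 * x - 3).
(* The supremum of the slopes allowed by [gaussE_polar] for [D = 1 + delta]. *)
Let tau : R := Num.sqrt (4 / (1 + delta) ^+ 2 - 2).
(* Close to the value [3 / (2 n)] of [b] which maximizes [cone_prob]; the shift
   from [n] to [t] serves small dimensions. *)
Let b : R := 3 / (2 * t).

Hypothesis n2 : (2 <= n)%N.

Let x3 : 3 <= x. Proof. by rewrite ler_nat. Qed.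

Let delta_bound : 0 < delta <= 1 / 10.
Proof.
have u3 : 3 <= 2 * x - 3 by move: x3; lra.
by rewrite divr_gt0 ?ler_pdivrMr//=; move: u3; lra.
Qed.

Let tau2_gt0 : 0 < 4 / (1 + delta) ^+ 2 - 2.
Proof.
have /andP[d0 d1] := delta_bound.
rewrite subr_gt0 ltr_pdivlMr ?exprn_gt0//; last lra.
nra.
Qed.

(** The factor e^(-1/2) from [tail_cst] offsets the growth (1 + 1/t)^(n/2) that [b] adds to
    (3/2)^(n/2), so that only sqrt x and bounded factors remain. *)
Lemma inv_cone_prob_le :
  (cone_prob n tau b)^-1 <= Num.sqrt 8 * Num.sqrt (pi / 3) * Num.sqrt (3 / 2) ^+ n *
    ((57 / 50 + 127 / 50 / x) * Num.sqrt x).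
Proof.
have x0 : 0 < x by move: x3; lra.
have t0 : 0 < t by rewrite /t; lra.
set P := Num.sqrt (pi / 3); set Q := Num.sqrt (3 / 2) ^+ n.
have P0 : 0 < P by rewrite sqrtr_gt0 divr_gt0// pi_gt0.
have Q0 : 0 < Q by rewrite exprn_gt0// sqrtr_gt0.
pose w : R := 1 + 3 / t.
have w0 : 0 < w by rewrite addr_gt0// divr_gt0.
have bw : 1 + 2 * b = w by rewrite /b /w; field; rewrite gt_eqF.
pose h : R := (1 / 5 + 39 / 50 / x) / (x - 1).
pose q := 1 + w / (4 / (1 + delta) ^+ 2 - 2).
have q0 : 0 < q by rewrite addr_gt0// divr_gt0.
have sqrt_q : Num.sqrt q <= Num.sqrt (3 / 2) * expR ((1 / t + h) / 2).
  have -> : expR ((1 / t + h) / 2) = Num.sqrt (expR (1 / t + h)).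
    rewrite -[LHS]ger0_norm ?expR_ge0// -sqrtr_sqr -expRM_natl; congr (Num.sqrt (expR _)).
    by field; rewrite gt_eqF.
  rewrite -sqrtrM// ler_wsqrtr// (le_trans (slope_bound x3))//.
  rewrite -/t -/h -mulrA ler_pM2l// expRD.
  have x1 : 0 < x - 1 by move: x3; lra.
  have h0 : 0 <= h by rewrite divr_ge0 ?(ltW x1)// addr_ge0// divr_ge0// ltW.
  apply: ler_pM; rewrite ?expR_ge1Dx ?addr_ge0//.
  by rewrite divr_ge0// ltW.
have s6 : 0 < Num.sqrt 6 :> R by rewrite sqrtr_gt0.
have s3 : 0 < Num.sqrt 3 :> R by rewrite sqrtr_gt0.
have st : 0 < Num.sqrt t by rewrite sqrtr_gt0.
have sq : 0 < Num.sqrt q ^+ n by rewrite exprn_gt0// sqrtr_gt0.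
have eh : 0 < expR (1 / 2) :> R by exact: expR_gt0.
have tailE : tail_cst b = Num.sqrt 3 * expR (1 / 2) / (Num.sqrt t * Num.sqrt 6 * P * w).
  rewrite /tail_cst bw.
  have -> : Num.sqrt (pi *+ 2) = Num.sqrt 6 * P :> R.
    by rewrite -sqrtrM//; congr Num.sqrt; field.
  have -> : Num.sqrt (2 * expR 1 * b) = Num.sqrt 3 * expR (1 / 2) / Num.sqrt t.
    have -> : expR (1 / 2) = Num.sqrt (expR 1) :> R.
      rewrite -[LHS]ger0_norm ?expR_ge0// -sqrtr_sqr -expRM_natl.
      by congr (Num.sqrt (expR _)); field.
    rewrite -sqrtrM// -sqrtrV ?(ltW t0)// -sqrtrM ?mulr_ge0 ?expR_ge0//.
    by congr Num.sqrt; rewrite /b; field; rewrite gt_eqF.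
  by field; rewrite !gt_eqF.
have probE : (cone_prob n tau b)^-1 = 2 * Num.sqrt 2 * (w * Num.sqrt t) * P *
    expR (- (1 / 2)) * Num.sqrt q ^+ n.
  rewrite /cone_prob.
  have -> : 1 + 2 * ((2^-1 + b) / tau ^+ 2) = q.
    rewrite sqr_sqrtr ?(ltW tau2_gt0)// /q -bw mulrA.
    by congr (1 + _ / _); field.
  have -> : Num.sqrt 2 = Num.sqrt 6 / Num.sqrt 3 :> R.
    by rewrite -sqrtrV// -sqrtrM//; congr Num.sqrt; field.
  rewrite tailE expRN exprVn; field.
  by rewrite !gt_eqF.
have sqrt8 : Num.sqrt 8 = 2 * Num.sqrt 2 :> R.
  have -> : 8 = 2 ^+ 2 * 2 :> R by rewrite -!natrX -natrM.
  by rewrite sqrtrM// sqrtr_sqr ger0_norm.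
rewrite probE sqrt8.
have qn : Num.sqrt q ^+ n <= Q * expR (n%:R * ((1 / t + h) / 2)).
  by rewrite expRM_natl -exprMn lerXn2r ?nnegrE ?mulr_ge0 ?sqrtr_ge0 ?expR_ge0.
apply: (@le_trans _ _ (2 * Num.sqrt 2 * P * Q * (w * Num.sqrt t *
    expR (- (2 / t) + 1 / 10 + 39 / 100 / x)))); last first.
  rewrite ler_wpM2l ?mulr_ge0 ?sqrtr_ge0 ?(ltW P0) ?(ltW Q0)//.
  exact: growth_bound.
have -> : - (2 / t) + 1 / 10 + 39 / 100 / x = - (1 / 2) + n%:R * ((1 / t + h) / 2).
  have -> : n%:R = x - 1 :> R by rewrite /x -natr1 addrK.
  have x1 : 0 < x - 1 by move: x3; lra.
  rewrite /h /t; move: x0 x1; move: (x) => z z0 z1.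
  by field; rewrite !gt_eqF//; lra.
rewrite expRD.
set K := expR (- _); set E := expR _ in qn *; set r := Num.sqrt q ^+ n in qn *.
have -> : 2 * Num.sqrt 2 * P * Q * (w * Num.sqrt t * (K * E)) =
  2 * Num.sqrt 2 * (w * Num.sqrt t) * P * K * (Q * E) by ring.
by rewrite ler_wpM2l// !mulr_ge0 ?sqrtr_ge0 ?expR_ge0// ltW.
Qed.

Lemma illuminable_bound (X : set 'rV[R]_n.+1) :
  X !=set0 -> compact X -> (diam X <= 1%:E)%E ->
  exists2 k, illuminable_by (ball_body X) k &
    k%:R < Num.sqrt 8 * Num.sqrt (pi / 3) * Num.sqrt (3 / 2) ^+ n *
      (Num.sqrt 3 * (x * Num.sqrt x) * (3 + ln x)).
Proof.
have sqrt3 : 71 / 41 <= Num.sqrt 3 :> R.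
  by rewrite -ler_sqr ?nnegrE ?sqrtr_ge0// sqr_sqrtr//; lra.
move=> X0 cX dX; have x0 : 0 < x by move: x3; lra.
set s := Num.sqrt x; set L := ln x.
have s2 : s ^+ 2 = x by rewrite sqr_sqrtr// ltW.
have s0 : 0 < s by rewrite sqrtr_gt0.
have s32 : 3 / 2 <= s.
  by rewrite -ler_sqr ?nnegrE ?(ltW s0)// s2; move: x3; lra.
(* Solves 2 s / y = delta, so any m > y gives cells of diameter below [delta]. *)
pose y := 20 / 3 * s * (2 * x - 3).
have u3 : 3 <= 2 * x - 3 by move: x3; lra.
have y0 : 0 < y by rewrite !mulr_gt0//; lra.
pose m := (Num.truncn y).+1.
have ym : y < m%:R by exact: truncnS_gt.
have my : m%:R <= y + 1 by rewrite -natr1 lerD2r truncn_le ltW.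
have /andP[d0 d1] := delta_bound.
pose D := 1 + 2 * s / m%:R.
have m0 : 0 < m%:R :> R by rewrite ltr0n.
have Dd : D < 1 + delta.
  rewrite ltrD2l ltr_pdivrMr//.
  have -> : 2 * s = delta * y by rewrite /delta /y; field; rewrite gt_eqF//; lra.
  by rewrite ltr_pM2l.
have D1 : 1 < D by rewrite ltrDl divr_gt0// mulr_gt0.
have tauD : (tau * D) ^+ 2 < 4 * (1 - D ^+ 2 / 2).
  rewrite exprMn sqr_sqrtr ?(ltW tau2_gt0)//.
  have : 4 / (1 + delta) ^+ 2 * D ^+ 2 < 4.
    rewrite mulrAC ltr_pdivrMr ?exprn_gt0//; last lra.
    by rewrite ltr_pM2l// ltr_sqr ?nnegrE//; lra.
  lra.
have b0 : 0 < b by rewrite divr_gt0// mulr_gt0// /t; lra.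
set p := cone_prob n tau b.
have p0 : 0 < p by exact: cone_prob_gt0.
(* Chosen so that the number of cells is at most e^(A + 1): after N >= A / p directions at most e <=
   3 cells are left. *)
pose A := x * (3 / 2 * L + 13 / 5) - 12 / 5.
have L0 : 0 <= L by rewrite ln_ge0//; move: x3; lra.
have A0 : 0 < A by rewrite /A; move: x3; nra.
pose N := (Num.truncn (A / p)).+1.
have AN : A / p < N%:R by exact: truncnS_gt.
have NA : N%:R <= A / p + 1 by rewrite -natr1 lerD2r truncn_le divr_ge0// ltW.
have tau0 : 0 < tau by rewrite sqrtr_gt0 tau2_gt0.
have [k Kk kN] := @illuminable_ball_body R n X m N tau b X0 cX dX isT tau0 tauD b0.
exists k => //.
have xL : expR L = x by rewrite lnK// posrE.
have sL : expR (1 / 2 * L) = s.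
  rewrite -[LHS]ger0_norm ?expR_ge0// -sqrtr_sqr -expRM_natl /s -[X in _ = Num.sqrt X]xL.
  congr (Num.sqrt (expR _)).
  by field.
have mE : m.+1%:R <= expR (13 / 5 + 3 / 2 * L - 7 / 5 / x).
  (* The correction 7/5 keeps 4/3 s of the term -20 s of [y]; since s >= 3/2 this absorbs the 2 lost
     in rounding. *)
  apply: (@le_trans _ _ (40 / 3 * (x * s) * (1 - 7 / 5 / x))).
    rewrite -natr1.
    have -> : 40 / 3 * (x * s) * (1 - 7 / 5 / x) = y + 1 + 1 + (4 / 3 * s - 2).
      by rewrite /y; field; rewrite gt_eqF.
    by move: my s32; lra.
  have -> : 13 / 5 + 3 / 2 * L - 7 / 5 / x = 13 / 5 + (L + 1 / 2 * L) + - (7 / 5 / x).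
    by field; rewrite gt_eqF.
  rewrite !expRD xL sL.
  have h1 : 0 <= 1 - 7 / 5 / x by rewrite subr_ge0 ler_pdivrMr//; move: x3; lra.
  apply: ler_pM => //; last exact: expR_ge1Dx.
    by rewrite !mulr_ge0// ltW.
  by rewrite ler_wpM2r ?expR_13_5_ge// mulr_ge0// ltW.
have left_over : expR (- (p * N%:R)) * m.+1%:R ^+ n.+1 <= 3.
  apply: le_trans (expR1_le3 R).
  have -> : expR 1 = expR (- A) * expR (A + 1) by rewrite -expRD addKr.
  apply: ler_pM; rewrite ?expR_ge0 ?exprn_ge0//.
    by rewrite ler_expR lerN2 mulrC -ler_pdivrMr// ltW.
  have -> : A + 1 = n.+1%:R * (13 / 5 + 3 / 2 * L - 7 / 5 / x).
    by rewrite -/x /A; field; rewrite gt_eqF.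
  by rewrite expRM_natl lerXn2r ?nnegrE ?expR_ge0.
apply: (le_lt_trans kN).
set P := Num.sqrt (pi / 3); set Q := Num.sqrt (3 / 2) ^+ n.
pose g : R := 57 / 50 + 127 / 50 / x.
set S := Num.sqrt 8.
have ip : p^-1 <= S * P * Q * (g * s) by exact: inv_cone_prob_le.
have P0 : 0 < P by rewrite sqrtr_gt0 divr_gt0// pi_gt0.
have Q0 : 0 < Q by rewrite exprn_gt0// sqrtr_gt0.
have S0 : 0 < S by rewrite sqrtr_gt0.
(* Rounding [N] costs 1 and the leftover cells cost 3. The margin 67/100 of [margin_bound], scaled
   by at least 6, exceeds these 4 and makes the final inequality strict. *)
have SPQs : 6 <= S * P * Q * s.
  rewrite -ler_sqr ?nnegrE ?mulr_ge0 ?(ltW s0) ?(ltW P0) ?(ltW Q0) ?(ltW S0)//.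
  rewrite !exprMn s2 !sqr_sqrtr ?divr_ge0 ?pi_ge0//.
  have Q2 : 9 / 4 <= Q ^+ 2.
    rewrite -exprM mulnC exprM sqr_sqrtr//.
    have -> : 9 / 4 = (3 / 2) ^+ 2 :> R by field.
    by rewrite ler_eXn2l//; lra.
  have pi2 : 2 / 3 <= pi / 3 :> R by rewrite ler_pM2r// pi_ge2.
  have h1 : 3 / 2 <= pi / 3 * Q ^+ 2.
    by apply: le_trans (ler_pM _ _ pi2 Q2); lra.
  have h2 : 9 / 2 <= pi / 3 * Q ^+ 2 * x.
    by apply: le_trans (ler_pM _ _ h1 x3); lra.
  by move: h2; lra.
have marg : A * g + 67 / 100 <= 71 / 41 * x * (3 + L).
  by apply: margin_bound => //; exact: ln_le_tangent.
have xL3 : 71 / 41 * (x * (3 + L)) <= Num.sqrt 3 * (x * (3 + L)).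
  by rewrite ler_wpM2r// mulr_ge0 ?(ltW x0)// addr_ge0.
have Ap : A / p <= S * P * Q * s * (A * g).
  have -> : S * P * Q * s * (A * g) = A * (S * P * Q * (g * s)) by ring.
  by rewrite ler_pM2l.
set V := S * P * Q * s in SPQs Ap.
have -> : S * P * Q * (Num.sqrt 3 * (x * s) * (3 + L)) = V * (Num.sqrt 3 * (x * (3 + L))).
  by rewrite /V; ring.
have h1 : V * (A * g + 67 / 100) <= V * (Num.sqrt 3 * (x * (3 + L))).
  rewrite ler_wpM2l//; first by rewrite (le_trans _ SPQs).
  by rewrite (le_trans marg)// -mulrA.
move: h1 Ap NA left_over SPQs; rewrite mulrDr.
set a1 := V * (A * g); set a2 := V * (_ * _); set a3 := A / p.
set a4 := expR _ * _; lra.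
Qed.

End cone_prob_bound.

Theorem theorem1p3 (R : realType) (d : nat) (X : set 'rV[R]_d)
    (hd : (3 <= d)%N) (hX0 : X !=set0) (hXc : compact X)
    (hdiam : (diam X <= 1%:E)%E) :
  spindle_convex_body (ball_body X) /\
  exists2 n : nat, is_illumination_number (ball_body X) n &
    n%:R < 4 * ((pi : R) / 3) `^ (1 / 2) * d%:R `^ (3 / 2) * (3 + ln d%:R)
             * (3 / 2) `^ (d%:R / 2)
         < 5 * d%:R `^ (3 / 2) * (4 + ln d%:R) * (3 / 2) `^ (d%:R / 2).
Proof.
split; first exact: spindle_ball_body.
case: d X hd hX0 hXc hdiam => [//|n] X n2 X0 cX dX.
have [k Kk kB] := illuminable_bound n2 X0 cX dX.
have [l Il lk] := exists_illumination_number Kk.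
exists l => //; set x : R := n.+1%:R in kB *.
have x3 : 3 <= x by rewrite ler_nat.
have x0 : 0 < x by lra.
have pE : (pi / 3) `^ (1 / 2) = Num.sqrt (pi / 3) :> R.
  by rewrite div1r powR12_sqrt// divr_ge0// pi_ge0.
have xE : x `^ (3 / 2) = x * Num.sqrt x.
  have -> : 3 / 2 = 1 + 2^-1 :> R by field.
  by rewrite powRD ?powRr1 ?powR12_sqrt ?(ltW x0)// gt_eqF// implybT.
have qE : (3 / 2) `^ (x / 2) = Num.sqrt (3 / 2) * Num.sqrt (3 / 2) ^+ n :> R.
  have -> : x / 2 = 2^-1 * n.+1%:R by rewrite mulrC.
  by rewrite powRrM powR12_sqrt// powR_mulrn ?sqrtr_ge0// exprS.
rewrite pE xE qE.
set P := Num.sqrt (pi / 3) in kB *; set s := Num.sqrt x in kB *.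
set Q := Num.sqrt (3 / 2) ^+ n in kB *; set W := Num.sqrt (3 / 2).
have Q0 : 0 < Q by rewrite exprn_gt0// sqrtr_gt0.
have s0 : 0 < s by rewrite sqrtr_gt0.
have W0 : 0 < W by rewrite sqrtr_gt0.
have L0 : 0 <= ln x by rewrite ln_ge0//; lra.
apply/andP; split.
  apply: (@le_lt_trans _ _ k%:R); first by rewrite ler_nat.
  (* Both are sqrt 24; the factor sqrt (3/2) completes the exponent from n to d = n + 1. *)
  have WE : Num.sqrt 8 * Num.sqrt 3 = 4 * W :> R.
    have -> : 4 = Num.sqrt (4 ^+ 2) :> R by rewrite sqrtr_sqr ger0_norm.
    by rewrite -!sqrtrM//; congr Num.sqrt; field.
  rewrite (lt_le_trans kB)// le_eqVlt; apply/orP; left; apply/eqP.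
  transitivity (Num.sqrt 8 * Num.sqrt 3 * (P * Q * (x * s) * (3 + ln x))); first by ring.
  by rewrite WE; ring.
(* Already pi < 4 suffices, since 4/3 <= 36/25; then 4 P <= 24/5 < 5. *)
have P1 : P <= 6 / 5.
  rewrite -[leRHS]ger0_norm// -sqrtr_sqr ler_wsqrtr//.
  by have := pihalf_lt2 R; lra.
rewrite ltr_pM2r ?mulr_gt0//.
have xs0 : 0 < x * s by rewrite mulr_gt0.
have -> : 4 * P * (x * s) * (3 + ln x) = x * s * (4 * P * (3 + ln x)) by ring.
have -> : 5 * (x * s) * (4 + ln x) = x * s * (5 * (4 + ln x)) by ring.
rewrite ltr_pM2l//.
have : P * (3 + ln x) <= 6 / 5 * (3 + ln x) by rewrite ler_wpM2r//; lra.
by lra.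
Qed.
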